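(* Let $(x,y)\in R_+ := \{(x,y)\in\mathbb{R}^2 \mid 0<x<y,\ y>1\}$ and consider the two-player game with an $(x,y)$-cube described in the context. The optimal (subjective) game state $d_k$ to raise, given that there are $k\ge 1$ proposals left to play, is $$d_k = \frac{y(x+1)}{2y+xy-x} + \frac{x(1+x)(y-1)}{2(2y+xy-x)}\left(-\frac{y-x}{y(1+x)}\right)^k .$$ Furthermore, raising at $d_k$ is preferable to not raising at all.
   Context: The game. Two players A and B play for a stake, initially $1$. The game state is a driftless Brownian motion $p=p(t)$ in $[0,1]$ started at $1/2$; $p$ reaching $1$ means victory for Player A and $p$ reaching $0$ means victory for Player B. The subjective game state of Player A is $p$ and that of Player B is $1-p$; all game states are subjective. A player's subjective state equals the probability that the player would win if there were no doubling; more generally, from a point of an interval the motion hits the right endpoint before the left one with probability equal to the proportion of the interval lying to the left of the point. The $(x,y)$-cube. At any game state in the closed interval $[0,1]$ (including $0$ and $1$, with the final payoff made afterward) a player who has the right to do so may propose a double (play the cube). The first proposal may be made by either player; after a proposal the right to make the next one goes to the opponent, so proposals alternate. When a double is proposed, the opponent either folds, which ends the game with the opponent paying the proposer $x$ times the current stake, or accepts, in which case the stake is multiplied by $y$ and play continues. If the state reaches $0$ or $1$ and neither player would double, the game ends, the winner receives the current stake and the loser pays it. ''$k$ proposals left'' means that at most $k$ further proposals can be made in total by the two players. For $(x,y)\in R_+$ the cube is called a raising cube and proposing a double is called raising. Both players play to maximize their expected payoff (and this is known to both). The optimal game state to raise is the subjective state at which it is optimal, for a player who has the right to make the next proposal,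 to raise. At the optimal raising state the payoff from raising, with the current stake normalized to $1$, is $x$; never raising from state $p$ results in an expected payoff of $2p-1$. ''Raising at $d_k$ is preferable to not raising at all'' means that the payoff $x$ of raising at $d_k$ exceeds $2d_k-1$. *)

(* Defs.v *)
From HB Require Import structures.
From mathcomp Require Export all_boot all_order all_algebra.
From mathcomp Require Export all_classical all_reals all_analysis.
Export Order.TTheory GRing.Theory Num.Theory numFieldNormedType.Exports.

Set Implicit Arguments.
Unset Strict Implicit.
Unset Printing Implicit Defensive.

Local Open Scope classical_set_scope.
Local Open Scope ring_scope.

Definition filtration (R : realType) (disp : measure_display)
    (Omega : measurableType disp) (F : R -> set (set Omega)) : Prop :=
  [/\ forall t, 0 <= t -> sigma_algebra setT (F t),
      forall t, 0 <= t -> F t `<=` measurable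
    & forall s t, 0 <= s -> s <= t -> F s `<=` F t].

(* Driftless Brownian motion with volatility sigma, started at 0, relative to
   the filtration F.  Times are the reals t >= 0; values at t < 0 are
   irrelevant.  The second parameter of normal_prob is the standard deviation.
   Taking A = setT in the last clause gives the law of the increments. *)
Definition brownian_motion (R : realType) (disp : measure_display)
    (Omega : measurableType disp) (P : probability Omega R)
    (F : R -> set (set Omega)) (sigma : R) (W : R -> Omega -> R) : Prop :=
  [/\ forall w, W 0 w = 0,
      forall w, {within `[0, +oo[, continuous (fun t => W t w)},
      forall t (B : set R), 0 <= t -> measurable B -> F t (W t @^-1` B)
    & forall (s t : R) (A : set Omega) (B : set R), 0 <= s -> s < t ->
        F s A -> measurable B ->
        (P (A `&` (fun w => W t w - W s w)%R @^-1` B) =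
         P A * normal_prob 0 (sigma * Num.sqrt (t - s))%R B)%E].

(* Random times with values in [0, +oo]; +oo means "never". *)
Definition stopping_time (R : realType) (disp : measure_display)
    (Omega : measurableType disp) (F : R -> set (set Omega))
    (tau : Omega -> \bar R) : Prop :=
  (forall w, (0 <= tau w)%E) /\
  (forall t, 0 <= t -> F t [set w | (tau w <= t%:E)%E]).

Definition never (R : realType) (Omega : Type) : Omega -> \bar R :=
  fun=> +oo%E.
Arguments never {R Omega}.

Section Game.
Context (R : realType) (disp : measure_display) (Omega : measurableType disp).
Implicit Types (p q d : R) (w : Omega) (W : R -> Omega -> R).
Implicit Types (tau tauA tauB : Omega -> \bar R).

Definition hitting_time W p (S : set R) : Omega -> \bar R :=
  fun w => ereal_inf [set t%:E | t in [set t | 0 <= t /\ S (p + W t w)]].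

Definition end_time W p : Omega -> \bar R := hitting_time W p [set 0; 1].

(* Payoff to player A, for a current stake of 1, of the stage of the game that
   starts in the (A-subjective) state p and lasts until the next proposal or
   the end of the game.  A proposes at time tauA and B at time tauB, provided
   the game is not yet over (a proposal at the very time where the state
   reaches 0 or 1 is allowed, and precedes the final payoff); never encodes a
   player without the right to propose.  "raise q" is the payoff to a player
   who proposes in his or her subjective state q.  A has precedence if both
   propose at once.  The last value, 0, occurs only on the null event that the
   motion never reaches 0 or 1. *)
Definition outcome W (raise : R -> R) p tauA tauB : Omega -> R := fun w =>
  let state t := p + W t w in
  let T := end_time W p w in
  if [&& tauA w <= tauB w, tauA w <= T & tauA w < +oo]%E
  then raise (state (fine (tauA w)))
  else if [&& tauB w <= T & tauB w < +oo]%E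
  then - raise (1 - state (fine (tauB w)))
  else if (T < +oo)%E
  then if state (fine T) == 1 then 1 else -1
  else 0.

Definition stage_payoff (P : probability Omega R) W (raise : R -> R) p
    tauA tauB : R :=
  fine 'E_P[outcome W raise p tauA tauB].

(* Payoff, for a current stake of 1, to a player who proposes in the subjective
   state p, when V q is the expected payoff, for a stake of 1, to a player who
   is in the subjective state q and has the right to make the next proposal:
   the opponent, who is in the subjective state 1 - p, chooses between folding
   and continuing with that right and with the stake y. *)
Definition proposal_payoff (x y : R) (V : R -> R) p : R :=
  - Num.max (- x) (y * V (1 - p)).

Variables (P : probability Omega R) (F : R -> set (set Omega)).
Variables (W : R -> Omega -> R) (x y : R).

(* Expected payoff under optimal play, for a stake of 1, to the player who has
   the exclusive right to make the next of at most k proposals and is in the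
   subjective state p (Markov property: the state after an accepted proposal is
   again a Brownian motion, started from where the proposal was made). *)
Fixpoint value (k : nat) : R -> R :=
  if k is k'.+1 then
    fun p => sup [set stage_payoff P W (proposal_payoff x y (value k')) p
                        tau never | tau in stopping_time F]
  else fun p => stage_payoff P W (fun=> 0) p never never.

(* For k >= 1. *)
Definition raise_payoff (k : nat) : R -> R :=
  proposal_payoff x y (value k.-1).

Definition payoff (k : nat) p tauA tauB : R :=
  stage_payoff P W (raise_payoff k) p tauA tauB.

Definition raise_at p d : Omega -> \bar R := hitting_time W p [set d].

(* d is the optimal subjective state to raise with k >= 1 proposals left:
   - for a player with the exclusive right to make the next proposal, raising
     is not optimal in any state below d, and raising as soon as the state is d
     is optimal from every state up to d;
   - before the first proposal, when either player may propose, it is an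
     equilibrium that each player raises as soon as his or her subjective state
     is d (for player B, this is the state 1 - d of player A). *)
Definition optimal_raising_state (k : nat) d : Prop :=
  [/\ 0 <= d <= 1,
      forall q, 0 <= q -> q < d -> raise_payoff k q < value k q,
      forall p, 0 <= p -> p <= d ->
        stopping_time F (raise_at p d) /\
        payoff k p (raise_at p d) never = value k p
    & forall p, 1 - d <= p -> p <= d ->
        forall tau, stopping_time F tau ->
          payoff k p tau (raise_at p (1 - d)) <=
            payoff k p (raise_at p d) (raise_at p (1 - d)) /\
          payoff k p (raise_at p d) (raise_at p (1 - d)) <=
            payoff k p (raise_at p d) tau].

End Game.

(* Main.v *)
Require Import Defs.
From mathcomp Require Import measurable_realfun ring lra.
Set Implicit Arguments.
Unset Strict Implicit.
Unset Printing Implicit Defensive.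
Local Open Scope classical_set_scope.
Local Open Scope ring_scope.

(** Every payoff in this game is compared with an affine function of the state,
    because affine functions of a Brownian motion stopped at the end of the
    game are martingales.  If the payoff of a stage is at most [a + b * X],
    where [X] is the state in which the stage stops, then its expectation from
    the state [p] is at most [a + b * p]; likewise for lower bounds and for
    equalities.

    Let [D k] be the thresholds given by [D 0 = (1 + x) / 2] and
    [D k.+1 = 1 - (y - x) / (y * (1 + x)) * D k]; solving this recursion gives
    the closed form of the theorem ([thresholdE]).  By induction on [k], the
    value [V k] of the player to propose is, up to the state [D k], the line
    [L k] from [-1] at state [0] to [x] at state [D k], and on the whole unit
    interval it lies between [2 * p - 1] and [L k] ([value_chord]).  Indeed the
    payoff from proposing is at most [x], is [x] at the state [q] for which the
    opponent is indifferent between folding and continuing, that is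
    [- y * L k (1 - q) = x], which is the recursion for [q = D k.+1], and it
    lies strictly below [L k.+1] before this state ([raise_at_threshold],
    [raise_lt_line]).  Hence [L k.+1] bounds the payoff of every strategy, and
    it is attained by proposing as soon as the state is [D k.+1].  The
    inequality [2 * D k - 1 < x] says that the line [L k] has slope more than
    [2], so that it also dominates the payoff of winning outright.

    When both players may propose, the line is replaced by the affine function
    with values [x] at [D k] and [- x] at [1 - D k]: it dominates the payoff
    from proposing ([raise_le_symmetric]), and by symmetry it is dominated by
    the payoff that remains when the opponent proposes, so neither player gains
    by leaving the threshold ([symmetric_equilibrium]).  A state other than
    [D k] is not optimal: below [D k] proposing pays strictly less than the
    value, and at [D k] it pays exactly the value.

    The probabilistic input is [optional_stopping].  A stopping time is
    rounded up to a grid, where the stopped motion is a finite sum of centered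
    increments.  The rounding can carry the motion outside the unit interval,
    and the error this causes is at most the sum of the fourth powers of the
    increments, which tends to 0 in mean when the mesh tends to 0 faster than
    the inverse of the horizon.  The payoffs need not be measurable in the
    sample point, since they involve values defined by suprema; the comparison
    of expectations only uses that the integral is monotone on bounded
    functions ([expectation_bounded_mono]). *)

(** * Expectations of bounded functions *)

Section BoundedExpectation.
Context d (T : measurableType d) (R : realType).

(** The integral of a nonnegative function is a supremum over the simple
    functions below it, hence monotone for arbitrary functions. *)
Lemma ge0_integral_mono (mu : {measure set T -> \bar R}) (f g : T -> \bar R) :
  (forall w, 0 <= f w)%E -> (forall w, f w <= g w)%E ->
  (\int[mu]_w f w <= \int[mu]_w g w)%E.
Proof.
move=> f0 fg; have g0 w : (0 <= g w)%E by exact: le_trans (fg w).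
rewrite !ge0_integralTE//; apply: le_ereal_sup => _ [h hf <-].
by exists h => // w; exact: le_trans (fg w).
Qed.

Lemma expectation_bounded_mono (P : probability T R) (f g : T -> R) (C : R) :
  (forall w, `|f w| <= C) -> (forall w, `|g w| <= C) ->
  (forall w, f w <= g w) -> fine 'E_P[f]%E <= fine 'E_P[g]%E.
Proof.
move=> fC gC fg.
have bnd (h : T -> \bar R) : (forall w, 0 <= h w <= C%:E)%E ->
    (\int[P]_w h w)%E \is a fin_num.
  move=> hC; rewrite ge0_fin_numE; last first.
    by apply: integral_ge0 => w _; case/andP: (hC w).
  apply: (@le_lt_trans _ _ (\int[P]_w (cst C%:E) w)%E).
    by apply: ge0_integral_mono => w; case/andP: (hC w).
  by rewrite integral_cst//= probability_setT mule1 ltry.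
have pos (h : T -> R) : (forall w, `|h w| <= C) ->
    (\int[P]_w ((EFin \o h) ^\+ w))%E \is a fin_num /\
    (\int[P]_w ((EFin \o h) ^\- w))%E \is a fin_num.
  move=> hC; have C0 (w : T) : 0 <= C by exact: le_trans (normr_ge0 (h w)) (hC w).
  by split; apply: bnd => w; have := hC w;
    rewrite ?funeposE ?funenegE /= -?EFinN -EFin_max !lee_fin;
    rewrite le_max lexx orbT/= ge_max (C0 w) andbT ler_norml => /andP[? ?];
    rewrite // lerNl.
have [fp fn] := pos _ fC; have [gp gn] := pos _ gC.
have E h : 'E_P[h]%E = (\int[P]_w ((EFin \o h) ^\+ w) -
                        \int[P]_w ((EFin \o h) ^\- w))%E.
  by rewrite unlock; exact: integralE.
rewrite !E; apply: fine_le; [by rewrite fin_numB fp fn|by rewrite fin_numB gp gn|].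
apply: leeB; apply: ge0_integral_mono => w.
- exact: funepos_ge0.
- by apply: (@funepos_le _ _ setT); rewrite ?inE// => v _; rewrite lee_fin.
- exact: funeneg_ge0.
- by apply: (@funeneg_le _ _ setT); rewrite ?inE// => v _; rewrite lee_fin.
Qed.

End BoundedExpectation.

(** * Paths and hitting times *)

Lemma continuous_min_norm1 (R : realType) :
  continuous (fun u : R => Num.min `|u| 1).
Proof.
have -> : (fun u : R => Num.min `|u| 1) =
    (fun u => (`|u| + 1 - `| `|u| - 1|) / 2).
  by apply/funext => u; rewrite minr_absE.
move=> u; apply: cvgM; last exact: cvg_cst.
by apply: cvgB; [|apply: cvg_norm; apply: cvgB; last exact: cvg_cst];
 [apply: cvgD; last exact: cvg_cst|]; exact: norm_continuous.
Qed.

Section Path.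
Context (R : realType) (d : measure_display) (Omega : measurableType d).
Variables (W : R -> Omega -> R) (w : Omega).
Hypothesis cW : {within `[0, +oo[, continuous (fun t => W t w)}.
Implicit Types (p t : R) (phi : R -> R).

(** The absolute value extends the path to all real times, which gives
    continuity on the whole line. *)
Lemma continuous_path p : continuous (fun t => p + W `|t| w).
Proof.
move=> t; apply: cvgD; first exact: cvg_cst.
have /(_ `|t|) := (subspace_continuousP _ _).1 cW.
rewrite /= in_itv/= andbT normr_ge0 => /(_ isT) h.
have h2 : (fun s : R => `|s|) @ nbhs t --> within `[0, +oo[ (nbhs `|t|).
  move=> U nU; have H : nbhs t (fun s : R => `[0, +oo[%classic `|s| -> U `|s|).
    exact: (@norm_continuous R R^o t _ nU).
  have : nbhs t (fun s : R => U `|s|).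
    by apply: filterS H => s; apply; rewrite /= in_itv/= andbT.
  by [].
exact: cvg_comp h2 h.
Qed.

(** The zero set of a continuous function is closed, so a finite hitting time
    is attained. *)
Lemma hitting_timeP p (S : set R) phi : continuous phi ->
  S = phi @^-1` [set 0] ->
  (hitting_time W p S w = +oo%E /\ forall t, 0 <= t -> ~ S (p + W t w)) \/
  exists t, [/\ hitting_time W p S w = t%:E, 0 <= t, S (p + W t w) &
    forall s, 0 <= s -> S (p + W s w) -> t <= s].
Proof.
move=> cphi ->{S}; set S := (X in hitting_time _ _ X).
set A := [set t | 0 <= t /\ S (p + W t w)].
have [A0|/set0P An0] := eqVneq A set0.
  left; split; first by rewrite /hitting_time -/A A0 image_set0 ereal_inf0.
  by move=> t t0 St; have : A t by []; rewrite A0.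
have lbA : has_lbound A by exists 0 => t [].
right; exists (inf A).
have hinf : has_inf A by [].
have clA : closed A.
  have -> : A = `[0, +oo[ `&` (fun t => phi (p + W `|t| w)) @^-1` [set 0].
    apply/seteqP; split => t; rewrite /A /S /= in_itv/= andbT => -[t0].
      by rewrite ger0_norm.
    by rewrite ger0_norm.
  apply: closedI; first exact: rray_closed.
  apply: preimage_closed; last exact: closed_eq.
  by move=> t _; apply: continuous_comp; [exact: (continuous_path)|exact: cphi].
have Ainf : A (inf A).
  apply: clA => B /nbhs_ballP[e /= e0 eB].
  have [t At tlt] := inf_adherent e0 hinf.
  exists t; split => //; apply: eB; rewrite /ball/=.
  by rewrite ltr_distlC (lt_le_trans _ (ge_inf lbA At)) ?ltrBlDr ?ltrDl.
case: (Ainf) => i0 Si; split => //.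
  rewrite /hitting_time -/A; apply/eqP; rewrite eq_le; apply/andP; split.
    by apply: ereal_inf_lbound; exists (inf A).
  by apply: le_ereal_inf_tmp => _ [t At <-]; rewrite lee_fin; exact: ge_inf.
by move=> s s0 Ss; apply: ge_inf.
Qed.

Lemma path_ivt p s t v : 0 <= s -> s <= t ->
  (p + W s w - v) * (p + W t w - v) <= 0 ->
  exists c, [/\ s <= c, c <= t & p + W c w = v].
Proof.
move=> s0 st sv; have t0 := le_trans s0 st.
have hv : Num.min (p + W s w) (p + W t w) <= v <= Num.max (p + W s w) (p + W t w).
  by rewrite ge_min le_max; move: sv; have [] := leP (p + W s w) v;
    have [] := leP (p + W t w) v; rewrite ?andbT ?orbT ?orbF//= => *; nra.
have [|c] := @IVT R (fun t => p + W `|t| w) s t v st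
  (continuous_subspaceT (@continuous_path p)); first by rewrite !ger0_norm.
rewrite in_itv/= => /andP[sc ct]; rewrite ger0_norm; last exact: le_trans sc.
by move=> <-; exists c.
Qed.

End Path.

Section StoppingTimes.
Context (R : realType) (d : measure_display) (Omega : measurableType d).
Variables (F : R -> set (set Omega)) (W : R -> Omega -> R).
Hypothesis hF : filtration F.
Hypothesis cW : forall w, {within `[0, +oo[, continuous (fun t => W t w)}.
Hypothesis aW : forall t (B : set R), 0 <= t -> measurable B ->
  F t (W t @^-1` B).
Implicit Types (p t : R) (phi : R -> R).

Lemma filtration_bigcup_rat t (A : rat -> set Omega) : 0 <= t ->
  (forall q, F t (A q)) -> F t (\bigcup_q A q).
Proof.
move=> t0 FA; have [/(_ t t0)[F0 _ FU] _ _] := hF.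
have -> : \bigcup_q A q =
    \bigcup_(n : nat) (if unpickle n is Some q then A q else set0).
  apply/seteqP; split => [w [q _ Aq]|w [n _]].
    by exists (pickle q); [exact: I|rewrite pickleK].
  by case: unpickle => // q Aq; exists q.
by apply: FU => n; case: unpickle.
Qed.

Lemma filtration_setC t (A : set Omega) : 0 <= t -> F t A -> F t (~` A).
Proof.
by move=> t0 FA; have [/(_ t t0)[_ FC _] _ _] := hF; rewrite -setTD; exact: FC.
Qed.

Lemma filtration_bigcap t (A : nat -> set Omega) : 0 <= t ->
  (forall n, F t (A n)) -> F t (\bigcap_n A n).
Proof.
move=> t0 FA; rewrite -[X in F t X]setCK setC_bigcap; apply: filtration_setC => //.
have [/(_ t t0)[_ _ FU] _ _] := hF; apply: FU => n; exact: filtration_setC.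
Qed.

Lemma stopping_time_never : stopping_time F never.
Proof.
split=> [w|t t0]; first by rewrite leey.
rewrite (_ : [set _ | _] = set0); first by have [/(_ t t0)[]] := hF.
by apply/seteqP; split => w //=; rewrite /never leye_eq.
Qed.

Lemma stopping_time_min (S T : Omega -> \bar R) : stopping_time F S ->
  stopping_time F T -> stopping_time F (fun w => mine (S w) (T w)).
Proof.
move=> [S0 hS] [T0 hT]; split => [w|t t0]; first by rewrite le_min S0 T0.
rewrite (_ : [set _ | _] =
  \bigcup_q (if q == 0 :> rat then [set w | (S w <= t%:E)%E]
             else [set w | (T w <= t%:E)%E])).
  by apply: filtration_bigcup_rat => // q; case: ifP => _; [exact: hS|exact: hT].
apply/seteqP; split => w /=; rewrite ge_min.
  by case/orP => h; [exists 0|exists 1].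
by move=> [q _]; case: ifP => _ /= ->; rewrite ?orbT.
Qed.

(** A continuous path meets the zero set of [phi] before time [t] iff the
    infimum of [|phi|] over a countable dense set of times vanishes: by
    compactness of the time interval the infimum is attained. *)
Lemma stopping_time_hitting p (S : set R) phi : continuous phi ->
  S = phi @^-1` [set 0] -> stopping_time F (hitting_time W p S).
Proof.
move=> cphi SE; split=> [w|t t0].
  have [[-> _]|[t [-> t0 _ _]]] := hitting_timeP (@cW w) p cphi SE.
    by rewrite leey.
  by rewrite lee_fin.
(* Rational [q] range over a dense subset of the line, and [s] maps the line
   continuously onto the interval from 0 to [t]. *)
pose s (q : R) := t * Num.min `|q| 1.
have cs : continuous s.
  by move=> q; apply: cvgM; [exact: cvg_cst|exact: continuous_min_norm1].
have st q : 0 <= s q <= t.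
  by rewrite /s mulr_ge0 ?le_min ?normr_ge0//= -[leRHS]mulr1 ler_wpM2l// ge_min lexx orbT.
pose f w (q : R) := `|phi (p + W (s q) w)|.
have cf w : continuous (f w).
  have -> : f w = (fun u => `|phi (p + W `|u| w)|) \o s.
    by apply/funext => q; rewrite /f/= (@ger0_norm _ (s q))//; case/andP: (st q).
  move=> q; apply: continuous_comp; first exact: cs.
  apply: cvg_norm; apply: continuous_comp; last exact: cphi.
  exact: (continuous_path (@cW w)).
rewrite (_ : [set _ | _] =
    \bigcap_(n : nat) \bigcup_(q : rat) [set w | f w (ratr q) < n.+1%:R^-1]).
  apply: filtration_bigcap => // n; apply: filtration_bigcup_rat => // q.
  have [_ _ Fmono] := hF; have /andP[s0 s1] := st (ratr q).
  apply: (Fmono (s (ratr q)) t) => //.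
  rewrite (_ : [set _ | _] = W (s (ratr q)) @^-1`
     ((fun u => `|phi (p + u)|) @^-1` [set v | v < n.+1%:R^-1])); last by [].
  apply: aW => //; apply: open_measurable; apply: open_comp; last exact: open_lt.
  move=> u _; apply: cvg_norm; apply: continuous_comp; last exact: cphi.
  by apply: cvgD; [exact: cvg_cst|exact: cvg_id].
apply/seteqP; split => w /=.
  have [[-> _]|[u [-> u0 Su _]]] := hitting_timeP (@cW w) p cphi SE.
    by rewrite leye_eq.
  rewrite lee_fin => ut n _.
  have [q0 sq0] : exists q0, s q0 = u.
    have [t1|t1] := ltP 0 t; last first.
      exists 0; rewrite /s normr0.
      have -> : u = 0 by apply/eqP; rewrite eq_le u0 andbT (le_trans ut).
      by rewrite min_l// mulr0.
    exists (u / t); rewrite /s ger0_norm ?divr_ge0// min_l.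
      by rewrite mulrC divfK// gt_eqF.
    by rewrite ler_pdivrMr// mul1r.
  have oU : open (f w @^-1` [set v | v < n.+1%:R^-1]).
    by apply: open_comp; [move=> q _; exact: cf|exact: open_lt].
  have neU : f w @^-1` [set v | v < n.+1%:R^-1] !=set0.
    exists q0; rewrite /f/= sq0; move: Su; rewrite SE => /= ->.
    by rewrite normr0 invr_gt0.
  have [r [fr [q _ qr]]] := @dense_rat R _ neU oU.
  by exists q; rewrite //= qr.
move=> h.
have cg : {within `[0, t], continuous (fun u => `|phi (p + W `|u| w)|)}.
  apply: continuous_subspaceT => u; apply: cvg_norm; apply: continuous_comp.
    exact: (continuous_path (@cW w)).
  exact: cphi.
have [c] := EVT_min t0 cg; rewrite in_itv/= => /andP[c0 ct] cmin.
have Sc : S (p + W c w).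
  rewrite SE/=; apply/eqP/negPn/negP => ne0.
  have pos : 0 < `|phi (p + W c w)| by rewrite normr_gt0.
  have [n nlt] : exists n : nat, n.+1%:R^-1 < `|phi (p + W c w)|.
    by have [n] := ltr_add_invr pos; rewrite add0r; exists n.
  have [q _ /=] := h n I; rewrite /f => fq.
  have /andP[s0 s1] := st (ratr q).
  have := cmin (s (ratr q)); rewrite in_itv/= s0 s1 (ger0_norm s0) (ger0_norm c0) => /(_ isT).
  by rewrite leNgt (lt_trans fq nlt).
have [[_ /(_ c c0)]//|[u [-> u0 Su /(_ c c0 Sc)]]] := hitting_timeP (@cW w) p cphi SE.
by rewrite lee_fin => uc; exact: le_trans ct.
Qed.

End StoppingTimes.

(** * Moments of the normal law *)

Section NormalLaw.
Context (R : realType).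
Implicit Types s z : R.
Notation mu := (@lebesgue_measure R).

Lemma normal_prob_symmetric s (B : set R) : s != 0 -> measurable B ->
  normal_prob 0 s (-%R @^-1` B) = normal_prob 0 s B.
Proof.
move=> s0 mB; rewrite /normal_prob.
have mN : measurable_fun [set: measurableTypeR R]
  (-%R : measurableTypeR R -> measurableTypeR R) by [].
have mpdf : measurable_fun setT (fun x : R => (normal_pdf 0 s x)%:E).
  by apply/measurable_EFinP; exact: measurable_normal_pdf.
have <- : (\int[pushforward mu (-%R : _ -> measurableTypeR R)]_(x in B)
    (normal_pdf 0 s x)%:E = \int[mu]_(x in B) (normal_pdf 0 s x)%:E)%E.
  by apply: eq_measure_integral => A mA _; exact: lebesgue_measureN.
rewrite (ge0_integral_pushforward mN)//.
- by apply: eq_integral => x _ /=; rewrite !normal_pdfE// /normal_fun !subr0 sqrrN.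
- exact: measurable_funTS.
- by move=> x _; rewrite lee_fin normal_pdf_ge0.
Qed.

(** The normal density is a Radon-Nikodym derivative of the normal law, by
    almost everywhere uniqueness of the latter. *)
Lemma ge0_integral_normal_prob s (f : R -> \bar R) :
  (forall z, 0 <= f z)%E -> measurable_fun setT f ->
  (\int[normal_prob 0 s]_z f z = \int[mu]_z (f z * (normal_pdf 0 s z)%:E))%E.
Proof.
move=> f0 mf; have dom := @normal_prob_dominates R 0 s.
have mpdf : measurable_fun setT (fun x : R => (normal_pdf 0 s x)%:E).
  by apply/measurable_EFinP; exact: measurable_normal_pdf.
have iRN := Radon_Nikodym_SigmaFinite.f_integrable dom.
rewrite -(Radon_Nikodym_SigmaFinite.change_of_variables dom f0 measurableT mf).
apply: ge0_ae_eq_integral => //.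
- by apply: emeasurable_funM => //; exact: measurable_int iRN.
- by apply: emeasurable_funM.
- by move=> x _; rewrite mule_ge0//; exact: Radon_Nikodym_SigmaFinite.f_ge0.
- by move=> x _; rewrite mule_ge0// lee_fin normal_pdf_ge0.
- apply: ae_eqe_mul2l; apply: integral_ae_eq => // E _ mE.
  by rewrite -Radon_Nikodym_SigmaFinite.f_integral.
Qed.

(** The polynomial factor is absorbed by doubling the variance. *)
Lemma normal_pdf_moment4 s z : 0 < s ->
  z ^+ 4 * normal_pdf 0 s z <=
  64 * Num.sqrt 2 * s ^+ 4 * normal_pdf 0 (Num.sqrt 2 * s) z.
Proof.
move=> s0; have r0 : 0 < Num.sqrt 2 :> R by rewrite sqrtr_gt0.
have r2 : Num.sqrt 2 ^+ 2 = 2 :> R by rewrite sqr_sqrtr.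
rewrite !normal_pdfE ?gt_eqF ?mulr_gt0//.
have -> : normal_peak (Num.sqrt 2 * s) = normal_peak s / Num.sqrt 2.
  rewrite /normal_peak exprMn r2 -!mulrA -mulrnAr sqrtrM// invfM mulrC.
  by rewrite !mulrA.
have u0 : 0 <= z ^+ 2 / (4 * s ^+ 2) by rewrite divr_ge0// ?sqr_ge0// mulr_ge0// sqr_ge0.
set u := z ^+ 2 / (4 * s ^+ 2) in u0.
have zE : z ^+ 2 = 4 * s ^+ 2 * u.
  by rewrite /u mulrC divfK// gt_eqF// mulr_gt0// exprn_gt0.
have E1 : normal_fun 0 s z = expR (- u) * expR (- u).
  rewrite -expRD /normal_fun subr0 zE; congr expR; field; exact: lt0r_neq0.
have E2 : normal_fun 0 (Num.sqrt 2 * s) z = expR (- u).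
  rewrite /normal_fun subr0 zE exprMn r2; congr expR; field; exact: lt0r_neq0.
rewrite E1 E2 (_ : z ^+ 4 = 16 * s ^+ 4 * u ^+ 2); last first.
  by rewrite (exprM z 2 2) zE; ring.
(* The square of [1 + u / 2 <= expR (u / 2)]. *)
have key : u ^+ 2 * expR (- u) <= 4.
  have h1 : 1 + u / 2 <= expR (u / 2) by exact: expR_ge1Dx.
  have h2 : expR (- u) * (expR (u / 2) * expR (u / 2)) = 1.
    by rewrite -!expRD; rewrite (_ : _ + _ = 0) ?expR0//; field.
  have h3 := expR_gt0 (- u).
  have h4 : u ^+ 2 <= 4 * (expR (u / 2) * expR (u / 2)) by nra.
  nra.
have pk : 0 < normal_peak s by rewrite normal_peak_gt0// gt_eqF.
have e0 := expR_gt0 (- u).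
have A : 0 <= 16 * s ^+ 4 * normal_peak s * expR (- u).
  by rewrite !mulr_ge0 ?exprn_ge0// ltW.
rewrite [leRHS](_ : _ = (16 * s ^+ 4 * normal_peak s * expR (- u)) * 4); last first.
  by field; exact: lt0r_neq0.
rewrite [leLHS](_ : _ = (16 * s ^+ 4 * normal_peak s * expR (- u)) *
  (u ^+ 2 * expR (- u))); last by ring.
exact: ler_wpM2l.
Qed.

Lemma normal_moment4 s : 0 < s ->
  (\int[normal_prob 0 s]_z (z ^+ 4)%:E <= (64 * Num.sqrt 2 * s ^+ 4)%:E)%E.
Proof.
move=> s0; have mz4 : measurable_fun setT (fun z : R => (z ^+ 4)%:E).
  by apply/measurable_EFinP; exact: measurable_funX.
have z40 (z : R) : (0 <= (z ^+ 4)%:E)%E by rewrite lee_fin exprn_even_ge0.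
rewrite ge0_integral_normal_prob//.
pose c := 64 * Num.sqrt 2 * s ^+ 4.
have c0 : 0 <= c by rewrite !mulr_ge0 ?exprn_ge0 ?ltW// sqrtr_gt0.
rewrite [leRHS](_ : _ = \int[mu]_z (c%:E * (normal_pdf 0 (Num.sqrt 2 * s) z)%:E))%E.
  apply: ge0_integral_mono => z.
    by rewrite mule_ge0// lee_fin normal_pdf_ge0.
  by rewrite -!EFinM lee_fin; exact: normal_pdf_moment4.
rewrite integralZl//; last exact: integrable_normal_pdf.
by rewrite integral_normal_pdf mule1.
Qed.

(** The density is at most its peak, which is at most half of [s^-1] because
    [pi] is at least 2. *)
Lemma normal_prob_small s : 0 < s ->
  (normal_prob 0 s [set` `[(-1)%R, 1%R]] <= (s^-1)%:E)%E.
Proof.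
move=> s0; rewrite /normal_prob.
apply: (@le_trans _ _ (\int[mu]_(x in [set` `[(-1)%R, 1%R]])
  (cst (normal_peak s)%:E) x)%E).
  apply: ge0_le_integral => //=.
  - by move=> x _; rewrite lee_fin normal_pdf_ge0.
  - by apply: measurable_funTS; apply/measurable_EFinP; exact: measurable_normal_pdf.
  - by move=> x _; rewrite lee_fin normal_pdf_ub// gt_eqF.
rewrite integral_cst//= lebesgue_measure_itv/= lte_fin.
rewrite ifT; last by lra.
rewrite -EFinB -EFinM lee_fin opprK.
rewrite /normal_peak -ler_pdivlMr//.
have pi2 := pi_ge2 R.
have sq0 : 0 < s ^+ 2 * pi *+ 2 by rewrite pmulrn_lgt0// mulr_gt0// ?exprn_gt0// pi_gt0.
have s20 : 0 < s * (1 + 1) by rewrite mulr_gt0.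
rewrite -invfM lef_pV2 ?posrE ?sqrtr_gt0//.
rewrite -[leLHS]ger0_norm; last exact: ltW.
rewrite -sqrtr_sqr; apply: ler_wsqrtr; rewrite exprMn -mulrnAr ler_wpM2l ?sqr_ge0//.
lra.
Qed.
End NormalLaw.

(** * Increments of Brownian motion *)

Lemma symmetric_mean0 (R : realType) d (Omega : measurableType d)
    (P : probability Omega R) (Z : Omega -> R) :
  P.-integrable setT (EFin \o Z) ->
  (forall B : set R, measurable B -> P (Z @^-1` B) = P ((\- Z) @^-1` B)) ->
  (\int[P]_w (Z w)%:E = 0)%E.
Proof.
move=> iZ symZ.
have mZ : measurable_fun setT Z by apply/measurable_EFinP; exact: measurable_int iZ.
have mNZ : measurable_fun setT (\- Z) by exact: measurable_funN.
have iNZ : P.-integrable setT (EFin \o (\- Z)) by exact: integrableN iZ.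
have mE : measurable_fun [set: R] (@EFin R) by exact: EFin_measurable.
have E1 := integral_pushforward mZ mE iZ measurableT.
have E2 := integral_pushforward mNZ mE iNZ measurableT.
have E3 : (\int[P]_w (Z w)%:E = \int[P]_w (- Z w)%:E)%E.
  transitivity (\int[pushforward P Z]_y y%:E)%E; first by rewrite E1.
  transitivity (\int[pushforward P (\- Z)%R]_y y%:E)%E; last by rewrite E2.
  by apply: eq_measure_integral => B mB _; exact: symZ.
have fin := integrable_fin_num measurableT iZ.
have E4 : (\int[P]_w (- Z w)%:E = - \int[P]_w (Z w)%:E)%E.
  by rewrite -integralN//; exact: integrable_add_def.
move: E3; rewrite E4 -(fineK fin) -EFinN => -[e]; congr EFin.
by move: e; set v := fine _; lra.
Qed.

Definition increment (R : realType) (Omega : Type) (W : R -> Omega -> R)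
  (s t : R) (w : Omega) : R := W t w - W s w.

Section Brownian.
Context (R : realType) (d : measure_display) (Omega : measurableType d).
Variables (P : probability Omega R) (F : R -> set (set Omega)) (sigma : R).
Variable (W : R -> Omega -> R).
Hypotheses (hF : filtration F) (hsigma : 0 < sigma).
Hypothesis hW : brownian_motion P F sigma W.
Implicit Types (s t : R) (A : set Omega).

Lemma measurable_brownian t : 0 <= t -> measurable_fun setT (W t).
Proof.
move=> t0 _ B mB; rewrite setTI; have [_ _ aW _] := hW.
have [_ sub _] := hF; apply: (sub t t0); apply: aW => //.
Qed.

Lemma measurable_increment s t : 0 <= s -> s < t ->
  measurable_fun setT (increment W s t).
Proof.
move=> s0 st; apply: measurable_funB; apply: measurable_brownian => //.
exact: le_trans (ltW st).
Qed.

Local Notation std s t := (sigma * Num.sqrt (t - s)).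

Lemma increment_std_gt0 s t : s < t -> 0 < std s t.
Proof. by move=> st; rewrite mulr_gt0// sqrtr_gt0 subr_gt0. Qed.

Lemma past_increment_law s t A (B : set R) : 0 <= s -> s < t -> F s A ->
  measurable B -> P (A `&` increment W s t @^-1` B) =
  (P A * normal_prob 0%R (std s t) B)%E.
Proof. by have [_ _ _ h] := hW; exact: h. Qed.

Lemma increment_law s t (B : set R) : 0 <= s -> s < t -> measurable B ->
  P (increment W s t @^-1` B) = normal_prob 0 (std s t) B.
Proof.
move=> s0 st mB; have [_ _ _ /(_ s t setT B s0 st)] := hW.
rewrite setTI => ->//; first by rewrite probability_setT mul1e.
have [/(_ s s0)[F0 FC _] _ _] := hF.
by rewrite -setC0 -setTD; exact: FC.
Qed.

Lemma increment_moment4 s t : 0 <= s -> s < t ->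
  (\int[P]_w (increment W s t w ^+ 4)%:E <=
   (64 * Num.sqrt 2 * std s t ^+ 4)%:E)%E.
Proof.
move=> s0 st; apply: le_trans (normal_moment4 (increment_std_gt0 st)).
have mi : measurable_fun setT (increment W s t : Omega -> measurableTypeR R).
  exact: measurable_increment.
have mz4 : measurable_fun [set: measurableTypeR R] (fun z : R => (z ^+ 4)%:E).
  by apply/measurable_EFinP; exact: measurable_funX.
have E : (\int[pushforward P (increment W s t : Omega -> measurableTypeR R)]_z (z ^+ 4)%:E
    = \int[normal_prob 0 (std s t)]_z (z ^+ 4)%:E)%E.
  by apply: eq_measure_integral => B mB _; exact: increment_law.
rewrite -E (ge0_integral_pushforward mi)// => z _.
by rewrite lee_fin exprn_even_ge0.
Qed.

Lemma measurable_filtration t A : 0 <= t -> F t A -> measurable A.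
Proof. by move=> t0; have [_ sub _] := hF; exact: sub. Qed.

Lemma increment4_integrable s t : 0 <= s -> s < t ->
  P.-integrable setT (fun w => (increment W s t w ^+ 4)%:E).
Proof.
move=> s0 st; apply/integrableP; split.
  by apply/measurable_EFinP; apply: measurable_funX; exact: measurable_increment.
under eq_integral do rewrite gee0_abs ?lee_fin ?exprn_even_ge0//.
by rewrite (le_lt_trans (increment_moment4 s0 st))// ltry.
Qed.

(** The absolute value is at most one plus the fourth power. *)
Lemma past_increment_integrable s t A : 0 <= s -> s < t -> F s A ->
  P.-integrable setT (EFin \o (fun w => increment W s t w * \1_A w)).
Proof.
move=> s0 st FA; have mA := measurable_filtration s0 FA.
apply: (@le_integrable _ _ _ P setT measurableT _
  (cst 1%:E \+ (fun w => (increment W s t w ^+ 4)%:E))%E).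
- apply/measurable_EFinP; apply: measurable_funM; first exact: measurable_increment.
  exact: measurable_indic.
- move=> w _; rewrite /= lee_fin [leRHS]ger0_norm; last by rewrite addr_ge0// exprn_even_ge0.
  rewrite normrM; set v := increment W s t w.
  apply: (@le_trans _ _ `|v|).
    by rewrite ler_piMr// indicE; case: (_ \in _); rewrite ?normr1 ?normr0.
  rewrite -[v ^+ 4]ger0_norm ?exprn_even_ge0// normrX.
  have := normr_ge0 v; set u := `|v|; clearbody u => u0.
  have [u1|u1] := leP u 1.
    by rewrite (le_trans u1)// lerDl exprn_ge0.
  by rewrite (@le_trans _ _ (u ^+ 4)) ?lerDr// -[leLHS]expr1 ler_eXn2l.
- by apply: integrableD => //; [exact: finite_measure_integrable_cst|exact: increment4_integrable].
Qed.

(** Given a past event the increment has a symmetric law, so that cutting it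
    off to 0 outside the event leaves a symmetric law. *)
Lemma past_increment_mean0 s t A : 0 <= s -> s < t -> F s A ->
  (\int[P]_w (increment W s t w * \1_A w)%:E = 0)%E.
Proof.
move=> s0 st FA; have mA := measurable_filtration s0 FA.
apply: symmetric_mean0; first exact: past_increment_integrable.
have law (e : bool) (B : set R) : measurable B ->
  P ((fun w => (-1) ^+ e * (increment W s t w * \1_A w)) @^-1` B) =
  (P A * normal_prob 0%R (std s t) B + \d_(0%R : R) B * P (~` A))%E.
  move=> mB.
  pose G := [set u : R | B ((-1) ^+ e * u)].
  have mG : measurable G.
    by rewrite -[X in measurable X]setTI; apply: measurable_funM.
  rewrite (_ : _ @^-1` _ = (A `&` increment W s t @^-1` G)
     `|` (~` A `&` (if 0 \in B then setT else set0))).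
    rewrite measureU.
    - congr (_ + _)%E.
        transitivity (P A * normal_prob 0%R (std s t) G)%E.
          exact: past_increment_law.
        congr (_ * _)%E; rewrite /G; case: e {mG G}; rewrite ?expr1 ?expr0; last first.
          by congr normal_prob; apply/seteqP; split => u /=; rewrite mul1r.
        rewrite -[RHS]normal_prob_symmetric ?gt_eqF ?increment_std_gt0//.
        by congr normal_prob; apply/seteqP; split => u /=; rewrite mulN1r.
      rewrite diracE; case: (_ \in _) => /=; first by rewrite setIT mul1e.
      by rewrite setI0 measure0 mul0e.
    - apply: measurableI => //; rewrite -[X in measurable X]setTI.
      exact: (measurable_increment s0 st).
    - by apply: measurableI; [exact: measurableC|case: ifP].
    - by apply/seteqP; split => w //= [[Aw _] [nAw _]].
  apply/seteqP; split => w /=; have [Aw|nAw] := pselect (A w).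
  - by rewrite indicE (mem_set Aw) mulr1 => Bw; left.
  - by rewrite indicE (memNset nAw) !mulr0 => B0; right; split => //; rewrite mem_set.
  - by rewrite indicE (mem_set Aw) mulr1 => -[[]|[]].
  - rewrite indicE (memNset nAw) !mulr0 => -[[]//|[_]].
    by case: ifPn => // /set_mem.
move=> B mB; have := law false B mB; have := law true B mB.
rewrite expr0 expr1 => <-.
rewrite [in LHS](_ : (fun w => 1 * _) = (fun w => increment W s t w * \1_A w));
  last by apply/funext => w; rewrite mul1r.
by move=> ->; congr (P _); apply/seteqP; split => w /=; rewrite mulN1r.
Qed.

End Brownian.

(** * Optional stopping *)

Section ExitTime.
Context (R : realType) (d : measure_display) (Omega : measurableType d).
Variables (P : probability Omega R) (F : R -> set (set Omega)) (sigma : R).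
Variable (W : R -> Omega -> R).
Hypotheses (hF : filtration F) (hsigma : 0 < sigma).
Hypothesis hW : brownian_motion P F sigma W.
Implicit Types (p t : R) (w : Omega).

Lemma brownian0 w : W 0 w = 0. Proof. by have [] := hW. Qed.

Lemma brownian_continuous w : {within `[0, +oo[, continuous (fun t => W t w)}.
Proof. by have [_ h _ _] := hW; exact: h. Qed.

Lemma hitting_time_singletonP p (e : R) w :
  (hitting_time W p [set e] w = +oo%E /\ forall t, 0 <= t -> p + W t w <> e) \/
  exists t, [/\ hitting_time W p [set e] w = t%:E, 0 <= t, p + W t w = e &
    forall s, 0 <= s -> p + W s w = e -> t <= s].
Proof.
apply: (hitting_timeP (@brownian_continuous w) p (phi := fun u => u - e)).
  by move=> u; apply: cvgB; [exact: cvg_id|exact: cvg_cst].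
by apply/seteqP; split => u /=; [move=> ->; rewrite subrr|move/eqP; rewrite subr_eq0 => /eqP].
Qed.

Lemma stopping_time_raise_at p e : stopping_time F (raise_at W p e).
Proof.
have [_ _ aW _] := hW.
apply: (@stopping_time_hitting _ _ _ _ _ hF (@brownian_continuous) aW p _ (fun u => u - e)).
  by move=> u; apply: cvgB; [exact: cvg_id|exact: cvg_cst].
by apply/seteqP; split => u /=; [move=> ->; rewrite subrr|move/eqP; rewrite subr_eq0 => /eqP].
Qed.

(* The end of the game is the first zero of a continuous function. *)
Let phi01 (u : R) := u * (1 - u).

Let continuous_phi01 : continuous phi01.
Proof.
move=> u; apply: cvgM; first exact: cvg_id.
by apply: cvgB; [exact: cvg_cst|exact: cvg_id].
Qed.

Let phi01E : [set 0; 1] = phi01 @^-1` [set 0].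
Proof.
apply/seteqP; split => u /=; rewrite /phi01.
  by case=> ->; rewrite ?mul0r ?subrr ?mulr0.
by move/eqP; rewrite mulf_eq0 subr_eq0 => /orP[/eqP|/eqP <-]; [left|right].
Qed.

Lemma stopping_time_end p : stopping_time F (end_time W p).
Proof.
have [_ _ aW _] := hW.
exact: (@stopping_time_hitting _ _ _ _ _ hF (@brownian_continuous) aW p _ _ continuous_phi01).
Qed.

Lemma end_timeP p w :
  (end_time W p w = +oo%E /\
    forall t, 0 <= t -> p + W t w <> 0 /\ p + W t w <> 1) \/
  exists t, [/\ end_time W p w = t%:E, 0 <= t,
    p + W t w = 0 \/ p + W t w = 1 &
    forall s, 0 <= s -> p + W s w = 0 \/ p + W s w = 1 -> t <= s].
Proof.
rewrite /end_time; have [[-> h]|h] := hitting_timeP (@brownian_continuous w) p continuous_phi01 phi01E.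
  by left; split => // t t0; split => e; apply: (h t t0); [left|right].
by right.
Qed.

Lemma crossing p s t w v : 0 <= s -> s <= t ->
  (p + W s w - v) * (p + W t w - v) <= 0 ->
  exists c, [/\ s <= c, c <= t & p + W c w = v].
Proof. by move=> s0 st h; exact: (path_ivt (@brownian_continuous w) s0 st h). Qed.

Lemma state_in01 p t w : 0 <= p <= 1 -> 0 <= t -> (t%:E <= end_time W p w)%E ->
  0 <= p + W t w <= 1.
Proof.
move=> /andP[p0 p1] t0 tT.
have out v : v = 0 \/ v = 1 -> (p - v) * (p + W t w - v) <= 0 ->
    0 <= p + W t w <= 1.
  move=> v01 hv; have [|c [c0 ct Xc]] := @crossing p 0 t w v (lexx 0) t0.
    by rewrite brownian0 addr0.
  have tc : t = c.
    apply/eqP; rewrite eq_le ct andbT.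
    have Xc01 : p + W c w = 0 \/ p + W c w = 1 by rewrite Xc.
    have [[_ /(_ c c0)[n0 n1]]|[T [TE T0 _ /(_ c c0 Xc01)]]] := end_timeP p w.
      by case: Xc01.
    by move: tT; rewrite TE lee_fin => /le_trans; apply.
  by rewrite tc Xc; case: v01 => ->; rewrite lexx ler01.
have /orP[X0|X0] := le_total 0 (p + W t w); last first.
  by apply: (@out 0); [left|rewrite !subr0; nra].
have /orP[X1|X1] := le_total (p + W t w) 1; first by rewrite X0.
by apply: (@out 1); [right|nra].
Qed.

(** An eternal game keeps the motion within distance 1 of its start at all
    times, which at late times has small probability by the density bound. *)
Lemma end_time_infinite p (A : set Omega) : 0 <= p <= 1 -> measurable A ->
  (forall w, A w -> end_time W p w = +oo%E) -> P A = 0%E.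
Proof.
move=> p01 mA AT.
have le n : (P A <= (sigma^-1 * n.+1%:R^-1)%:E)%E.
  pose t : R := n.+1%:R ^+ 2; have t0 : 0 < t by rewrite exprn_gt0.
  apply: (@le_trans _ _ (P (increment W 0 t @^-1` [set` `[(-1)%R, 1%R]]))).
    apply: le_measure; rewrite ?inE//.
      rewrite -[X in measurable X]setTI; apply: (measurable_increment hF hW) => //.
    move=> w Aw; rewrite /= in_itv/= /increment brownian0 subr0.
    have := state_in01 (w := w) p01 (ltW t0); rewrite AT// leey => /(_ isT).
    by move: p01; lra.
  rewrite (increment_law hF hW)//.
  apply: le_trans (normal_prob_small (increment_std_gt0 hsigma t0)) _.
  by rewrite lee_fin subr0 sqrtr_sqr ger0_norm// invfM.
apply/eqP; rewrite eq_le measure_ge0 andbT leNgt; apply/negP => PA0.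
have Pfin : P A \is a fin_num by exact: fin_num_measure.
move: le PA0; rewrite -(fineK Pfin) lte_fin => le PA0.
have [n] := ltr_add_invr (mulr_gt0 hsigma PA0); rewrite add0r.
have := le n; rewrite lee_fin ler_pdivlMl// => h1.
by rewrite ltNge h1.
Qed.

End ExitTime.

(** A sum of increments over the grid points preceding [s] telescopes to the
    increment up to the first grid point at or after [s]. *)
Lemma sum_increments_before (R : realType) (f g : nat -> R) (s : \bar R) K :
  (forall j, g j <= g j.+1) ->
  exists J, [/\ (J <= K)%N,
    \sum_(j < K) (f j.+1 - f j) * ((g j)%:E < s)%E%:R = f J - f 0%N,
    forall j, (j < J)%N -> ((g j)%:E < s)%E &
    (J < K)%N -> (s <= (g J)%:E)%E].
Proof.
move=> gS; elim: K => [|K [J [JK E lt ge]]].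
  by exists 0%N; split => //; rewrite big_ord0 subrr.
rewrite big_ord_recr/= E; have [Ks|sK] := ltP (g K)%:E s.
  have JE : J = K.
    apply/eqP; rewrite eqn_leq JK leqNgt; apply/negP => JK'.
    have := ge JK'; rewrite leNgt => /negP; apply; apply: le_lt_trans Ks.
    by rewrite lee_fin; apply/(homo_leq (@lexx _ _) (@le_trans _ _)).
  exists K.+1; split => //; first by rewrite JE mulr1; ring.
    by move=> j; rewrite ltnS leq_eqVlt => /predU1P[->//|]; rewrite -JE; exact: lt.
  by rewrite ltnn.
exists J; split => //; [exact: leqW|by rewrite mulr0 addr0|].
rewrite ltnS leq_eqVlt => /predU1P[->//|]; exact: ge.
Qed.

(** The retraction of the line onto the interval from -1 to 2, written with
    absolute values to make its continuity evident.  The margin around the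
    unit interval leaves increments of size at most 1 unaffected. *)
Definition clamp (R : realType) (z : R) : R := (`|z + 1| - `|z - 2| + 1) / 2.

Section Clamp.
Context (R : realType).
Implicit Types u v z : R.

Lemma clamp_id z : -1 <= z -> z <= 2 -> clamp z = z.
Proof. by move=> z1 z2; rewrite /clamp ger0_norm ?ler0_norm; lra. Qed.

Lemma clamp_bound z : `|clamp z| <= 2.
Proof.
by rewrite ler_norml /clamp; case: (ger0P (z + 1)); case: (ger0P (z - 2)); lra.
Qed.

(** Only an increment of size more than 1 leads out of the range of the
    retraction, and then its fourth power exceeds its size. *)
Lemma clamp_increment u v : 0 <= u <= 1 -> `|clamp (u + v) - (u + v)| <= v ^+ 4.
Proof.
move=> u01; have [v1|v1] := leP `|v| 1.
  rewrite clamp_id ?subrr ?normr0 ?exprn_even_ge0//.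
    by move: v1; rewrite ler_norml; lra.
  by move: v1; rewrite ler_norml; lra.
apply: (@le_trans _ _ `|v|); last first.
  rewrite -[v ^+ 4]ger0_norm ?exprn_even_ge0// normrX.
  by rewrite -[leLHS]expr1 ler_eXn2l// ltW.
rewrite ler_norml /clamp; case: (ger0P (u + v + 1)); case: (ger0P (u + v - 2));
  case: (ger0P v) v1; lra.
Qed.

Lemma continuous_clamp : continuous (@clamp R).
Proof.
move=> z; apply: cvgM; last exact: cvg_cst.
apply: cvgD; last exact: cvg_cst.
by apply: cvgB; apply: cvg_norm; [apply: cvgD|apply: cvgB];
  by [exact: cvg_id|exact: cvg_cst].
Qed.

End Clamp.

(** The value 0 at infinite times is that of [outcome], so that payoffs can be
    compared with stopped affine functions at every sample point. *)
Definition stopped_affine (R : realType) (Omega : Type) (W : R -> Omega -> R)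
    (p a b : R) (S : Omega -> \bar R) (w : Omega) : R :=
  if (S w < +oo)%E then a + b * (p + W (fine (S w)) w) else 0.

Section OptionalStopping.
Context (R : realType) (d : measure_display) (Omega : measurableType d).
Variables (P : probability Omega R) (F : R -> set (set Omega)) (sigma : R).
Variable (W : R -> Omega -> R).
Hypotheses (hF : filtration F) (hsigma : 0 < sigma).
Hypothesis hW : brownian_motion P F sigma W.
Variables (p : R) (S : Omega -> \bar R).
Hypotheses (p01 : 0 <= p <= 1) (stopS : stopping_time F S).
Hypothesis ST : forall w, (S w <= end_time W p w)%E.

(* At stage [n] the mesh is [h n] and the horizon is [K n * h n = n.+1]; the
   sum of the fourth powers has mean of order [K n * h n ^+ 2], the inverse of
   [n.+1]. *)
Let h n : R := (n.+1%:R ^+ 2)^-1.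
Let K n := (n.+1 ^ 3)%N.
Let g n j : R := j%:R * h n.
Let A n j : set Omega := [set w | ((g n j)%:E < S w)%E].
Let Z n w := p + \sum_(j < K n) increment W (g n j) (g n j.+1) w * \1_(A n j) w.
Let Q n w := \sum_(j < K n) increment W (g n j) (g n j.+1) w ^+ 4.
Let bound n : R := 64 * Num.sqrt 2 * sigma ^+ 4 / n.+1%:R.

Let h_gt0 n : 0 < h n. Proof. by rewrite invr_gt0 exprn_gt0. Qed.

Let g_ge0 n j : 0 <= g n j. Proof. by rewrite mulr_ge0// ltW. Qed.

Let gS n j : g n j.+1 = g n j + h n.
Proof. by rewrite /g -natr1 mulrDl mul1r. Qed.

Let g_lt n j : g n j < g n j.+1. Proof. by rewrite gS ltrDl. Qed.

Let FA n j : F (g n j) (A n j).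
Proof.
have [_ /(_ _ (g_ge0 n j)) FS] := stopS.
rewrite (_ : A n j = ~` [set w | (S w <= (g n j)%:E)%E]); first exact: filtration_setC.
by apply/seteqP; split => w; rewrite /A/= ltNge => /negP.
Qed.

Let Z_integrable n : P.-integrable setT (EFin \o Z n).
Proof.
rewrite (_ : EFin \o Z n = (cst p%:E \+ (fun w => \sum_(j < K n)
    (increment W (g n j) (g n j.+1) w * \1_(A n j) w)%:E))%E); last first.
  by apply/funext => w /=; rewrite sumEFin.
apply: integrableD => //; first exact: finite_measure_integrable_cst.
apply: integrable_sum => //= j _.
exact: (past_increment_integrable hF hsigma hW).
Qed.

Let Z_mean n : (\int[P]_w (Z n w)%:E = p%:E)%E.
Proof.
under eq_integral do rewrite EFinD -sumEFin.
rewrite integralD//; first last.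
- apply: integrable_sum => //= j _.
  exact: (past_increment_integrable hF hsigma hW).
- exact: finite_measure_integrable_cst.
rewrite integral_cst//= probability_setT mule1 integral_sum//; last first.
  by move=> j; exact: (past_increment_integrable hF hsigma hW).
rewrite big1 ?adde0// => j _.
exact: (past_increment_mean0 hF hsigma hW).
Qed.

Let Q_integrable n : P.-integrable setT (EFin \o Q n).
Proof.
rewrite (_ : EFin \o Q n = (fun w => \sum_(j < K n)
    (increment W (g n j) (g n j.+1) w ^+ 4)%:E)%E); last first.
  by apply/funext => w /=; rewrite sumEFin.
apply: integrable_sum => //= j _.
exact: (increment4_integrable hF hsigma hW).
Qed.

Let Q_mean n : (\int[P]_w (Q n w)%:E <= (bound n)%:E)%E.
Proof.
under eq_integral do rewrite -sumEFin.
rewrite integral_sum//; last first.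
  by move=> j; exact: (increment4_integrable hF hsigma hW).
apply: (@le_trans _ _ (\sum_(j < K n) (64 * Num.sqrt 2 * (sigma ^+ 4 * h n ^+ 2))%:E)%E).
  apply: lee_sum => j _.
  apply: le_trans (increment_moment4 hF hsigma hW (g_ge0 n j) (g_lt n j)) _.
  rewrite lee_fin gS addrC addKr exprMn (exprM (Num.sqrt _) 2 2).
  by rewrite sqr_sqrtr// ltW.
rewrite sumEFin lee_fin sumr_const card_ord -[leLHS]mulr_natr /bound /h /K natrX.
have n0 : n.+1%:R != 0 :> R by rewrite pnatr_eq0.
by rewrite le_eqVlt; apply/orP; left; apply/eqP; field.
Qed.

(** Before the first grid point at or after [S] the state is still in the unit
    interval, so that only the last increment can lead out of the range of
    the retraction. *)
Let Z_stopped n w : exists tau, [/\ 0 <= tau, Z n w = p + W tau w,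
  (S w <= n.+1%:R%:E -> S w <= tau%:E)%E,
  (0 <= S w -> tau%:E <= S w + (h n)%:E)%E &
  `|clamp (Z n w) - Z n w| <= Q n w].
Proof.
have [J [JK E lt ge]] := @sum_increments_before R (fun j => W (g n j) w) (g n) (S w)
  (K n) (fun j => ltW (g_lt n j)).
have W0 : W (g n 0) w = 0 by rewrite /g mul0r (brownian0 hW).
have ZE : Z n w = p + W (g n J) w.
  rewrite /Z; congr (_ + _); rewrite -[RHS]subr0 -[in RHS]W0 -E.
  apply: eq_bigr => j _; rewrite /increment indicE; congr (_ * _%:R).
  by congr nat_of_bool; apply/idP/idP; rewrite inE.
exists (g n J); split => //.
- move=> Sn; have [/ge//|KJ] := ltnP J (K n).
  apply: le_trans Sn _; rewrite lee_fin.
  have -> : J = K n by apply/eqP; rewrite eqn_leq JK.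
  rewrite /g /K /h natrX.
  have n0 : n.+1%:R != 0 :> R by rewrite pnatr_eq0.
  by rewrite le_eqVlt; apply/orP; left; apply/eqP; field.
- move=> S0; case: J {JK E ge ZE} lt => [_|J /(_ J (ltnSn J)) lt].
    by rewrite /g mul0r; apply: adde_ge0 => //; rewrite lee_fin ltW.
  by rewrite gS EFinD leeD2r// ltW.
have Q0 j : 0 <= increment W (g n j) (g n j.+1) w ^+ 4 by rewrite exprn_even_ge0.
rewrite ZE; case: J {E ge ZE} JK lt => [|J] JK lt.
  rewrite W0 addr0 clamp_id ?subrr ?normr0; [|by move: p01; lra..].
  exact: sumr_ge0.
apply: (@le_trans _ _ (increment W (g n J) (g n J.+1) w ^+ 4)); last first.
  by rewrite /Q (bigD1 (Ordinal JK))//= lerDl; apply: sumr_ge0.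
have -> : p + W (g n J.+1) w = (p + W (g n J) w) + increment W (g n J) (g n J.+1) w.
  by rewrite /increment; ring.
apply: clamp_increment; apply: (state_in01 hW) => //.
by apply: le_trans (ST w); exact/ltW/lt.
Qed.

Let S_ge0 w : (0 <= S w)%E. Proof. by case: stopS. Qed.

Let clampZ_cvg w : (S w < +oo)%E ->
  clamp (Z n w) @[n --> \oo] --> p + W (fine (S w)) w.
Proof.
move=> Soo; have Sfin : S w \is a fin_num by rewrite ge0_fin_numE.
have [s SE] : exists s, S w = s%:E by exists (fine (S w)); rewrite fineK.
have s0 : 0 <= s by have := S_ge0 w; rewrite SE.
rewrite SE /=.
have s01 : 0 <= p + W s w <= 1.
  by apply: (state_in01 hW) => //; rewrite -SE.
have /choice[tau Htau] := Z_stopped ^~ w.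
have tau_cvg : tau n @[n --> \oo] --> s.
  apply: (@squeeze_cvgr _ _ _ _ (fun n => s - harmonic n) (fun n => s + harmonic n)).
  - near=> n; have [t0 _ l u _] := Htau n; apply/andP; split.
      have : (s%:E <= (tau n)%:E)%E.
        rewrite -SE; apply: l; rewrite SE lee_fin.
        apply: (@le_trans _ _ n%:R); last by rewrite ler_nat.
        by near: n; exact: nbhs_infty_ger.
      by rewrite lee_fin; apply: le_trans; rewrite gerBl invr_ge0.
    have := u (S_ge0 w); rewrite SE -EFinD lee_fin => /le_trans; apply.
    rewrite lerD2l lef_pV2 ?posrE ?exprn_gt0//.
    by rewrite -[leLHS]expr1 ler_weXn2l// ler1n.
  - by rewrite -[X in _ --> X]subr0; apply: cvgB; [exact: cvg_cst|exact: cvg_harmonic].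
  - by rewrite -[X in _ --> X]addr0; apply: cvgD; [exact: cvg_cst|exact: cvg_harmonic].
rewrite -[X in _ --> X](clamp_id (z := p + W s w)); [|by move: s01; lra..].
have -> : (fun n => clamp (Z n w)) = (fun n => clamp (p + W `|tau n| w)).
  by apply/funext => n; have [t0 -> _ _ _] := Htau n; rewrite ger0_norm.
rewrite -[in X in _ --> X](ger0_norm s0).
apply: (continuous_cvg _ (@continuous_clamp R _)).
have cX := @continuous_path _ _ _ _ w (@brownian_continuous _ _ _ _ _ _ _ hW w) p.
exact: (cvg_comp tau (fun t => p + W `|t| w) tau_cvg (@cX s)).
Unshelve. all: by end_near. Qed.

Let Z_measurable n : measurable_fun setT (fun w => clamp (Z n w)).
Proof.
have mZ : measurable_fun setT (Z n).
  by apply/measurable_EFinP; exact: measurable_int (Z_integrable n).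
apply: (measurableT_comp _ mZ); apply: continuous_measurable_fun.
exact: continuous_clamp.
Qed.

Let infinite : set Omega := [set w | S w = +oo%E].

Let measurable_infinite : measurable infinite.
Proof.
rewrite (_ : infinite = ~` \bigcup_(n : nat) [set w | (S w <= n%:R%:E)%E]).
  apply: measurableC; apply: bigcupT_measurable => n.
  have [_ FS] := stopS.
  by apply: (measurable_filtration hF (t := n%:R)) => //; exact: FS.
apply/seteqP; split => w /=.
  by rewrite /infinite/= => SE [n _] /=; rewrite SE leye_eq.
move=> H; apply/eqP; rewrite -leye_eq leNgt; apply/negP => Soo; apply: H.
have Sfin : S w \is a fin_num by rewrite ge0_fin_numE.
exists (Num.truncn (fine (S w))).+1 => //=.
by rewrite -(fineK Sfin) lee_fin ltW// truncnS_gt.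
Qed.

Let negligible_infinite : P infinite = 0%E.
Proof.
apply: (end_time_infinite hF hsigma hW p01 measurable_infinite) => w /= SE.
by apply/eqP; rewrite -leye_eq; move: (ST w); rewrite SE.
Qed.

Lemma measurable_stopped_affine a b :
  measurable_fun setT (stopped_affine W p a b S).
Proof.
apply: (@measurable_fun_cvg _ _ _ _
  (fun n w => (a + b * clamp (Z n w)) * \1_(~` infinite) w)).
  move=> n; apply: measurable_funM; last by apply: measurable_indic; exact: measurableC.
  by apply: measurable_funD => //; apply: measurable_funM.
move=> w _; rewrite /stopped_affine indicE.
have [Soo|] := ltP (S w) +oo%E.
  rewrite mem_set; last by move=> /= SE; move: Soo; rewrite SE ltxx.
  under eq_fun do rewrite mulr1.
  apply: cvgD; first exact: cvg_cst.
  by apply: cvgM; [exact: cvg_cst|exact: clampZ_cvg].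
rewrite leye_eq => /eqP SE; rewrite memNset; last by apply.
by under eq_fun do rewrite mulr0; exact: cvg_cst.
Qed.

(** Optional stopping for the affine functions of the motion, up to the end of
    the game: the discretized times make the expectation exact before the
    retraction, which costs at most the sum of the fourth powers of the
    increments. *)
Theorem optional_stopping a b :
  'E_P[stopped_affine W p a b S]%E = (a + b * p)%:E.
Proof.
rewrite unlock.
pose f n w := a + b * clamp (Z n w).
have mf n : measurable_fun setT (f n).
  by apply: measurable_funD => //; apply: measurable_funM.
have f_bnd n w : `|f n w| <= `|a| + `|b| * 2.
  apply: le_trans (ler_normD _ _) _; rewrite lerD2l normrM ler_wpM2l//.
  exact: clamp_bound.
have f_int n : P.-integrable setT (EFin \o f n).
  apply: measurable_bounded_integrable => //.
    by rewrite (le_lt_trans (probability_le1 _ _))// ltry.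
  exists (`|a| + `|b| * 2); split; first exact: num_real.
  by move=> x xM w _; apply: le_trans (ltW xM); exact: f_bnd.
have [_ _ lim1] : [/\ P.-integrable setT (EFin \o stopped_affine W p a b S),
    (\int[P]_w `|(f n w)%:E - (stopped_affine W p a b S w)%:E|)%E @[n --> \oo] --> 0%E
    & (\int[P]_w (f n w)%:E)%E @[n --> \oo] -->
      (\int[P]_w (stopped_affine W p a b S w)%:E)%E].
  apply: (dominated_convergence measurableT (g := cst (`|a| + `|b| * 2)%:E)).
  - by move=> n; apply/measurable_EFinP.
  - by apply/measurable_EFinP; exact: measurable_stopped_affine.
  - exists infinite; split => // w /= nh; apply/eqP; rewrite -leye_eq leNgt.
    apply/negP => Soo; apply: nh => _; apply/cvg_EFin.
      by near=> n.
    rewrite /stopped_affine Soo; apply: cvgD; first exact: cvg_cst.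
    by apply: cvgM; [exact: cvg_cst|exact: clampZ_cvg].
  - exact: finite_measure_integrable_cst.
  - by apply: aeW => w n _; rewrite /= lee_fin.
have iaZ n : P.-integrable setT (EFin \o (fun w => a + b * Z n w)).
  rewrite (_ : EFin \o _ = (cst a%:E \+ (fun w => b%:E * (Z n w)%:E))%E)//.
  apply: integrableD => //; first exact: finite_measure_integrable_cst.
  exact: integrableZl (Z_integrable n).
have aZ_mean n : (\int[P]_w (a + b * Z n w)%:E = (a + b * p)%:E)%E.
  under eq_integral do rewrite EFinD EFinM.
  rewrite integralD//; first last.
  - exact: integrableZl (Z_integrable n).
  - exact: finite_measure_integrable_cst.
  rewrite integral_cst//= probability_setT mule1 integralZl//; last exact: Z_integrable.
  by rewrite Z_mean EFinD EFinM.
have f_mean n : (`|(\int[P]_w (f n w)%:E) - (a + b * p)%:E| <= (`|b| * bound n)%:E)%E.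
  rewrite -(aZ_mean n) -integralB_EFin//.
  apply: le_trans (le_abse_integral _ _ _) _ => //.
    apply/measurable_EFinP; apply: measurable_funB => //.
    by apply/measurable_EFinP; exact: measurable_int (iaZ n).
  apply: (@le_trans _ _ (\int[P]_w (`|b|%:E * (Q n w)%:E))%E); last first.
    rewrite integralZl//; last exact: Q_integrable.
    by rewrite EFinM lee_wpmul2l.
  apply: ge0_integral_mono => w //=.
  rewrite -EFinM lee_fin (_ : _ - _ = b * (clamp (Z n w) - Z n w)); last by rewrite /f; ring.
  by rewrite normrM ler_wpM2l//; have [tau []] := Z_stopped n w.
have lim2 : (\int[P]_w (f n w)%:E)%E @[n --> \oo] --> (a + b * p)%:E.
  pose c := `|b| * (64 * Num.sqrt 2 * sigma ^+ 4).
  have cE n : `|b| * bound n = c * harmonic n by rewrite /bound /c /= !mulrA.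
  apply: (@squeeze_cvge _ _ _ _ (fun n => (a + b * p - c * harmonic n)%:E) _
    (fun n => (a + b * p + c * harmonic n)%:E)).
  - apply: nearW => n; have := f_mean n.
    have -> : (\int[P]_w (f n w)%:E = (fine (\int[P]_w (f n w)%:E))%:E)%E.
      by rewrite fineK//; exact: (integrable_fin_num measurableT (f_int n)).
    by rewrite -EFinB abse_EFin !lee_fin ler_distl cE.
  - apply/cvg_EFin; first by near=> n.
    rewrite -[X in _ --> X]subr0; apply: cvgB; first exact: cvg_cst.
    by rewrite -[X in _ --> X](mulr0 c); apply: cvgM; [exact: cvg_cst|exact: cvg_harmonic].
  - apply/cvg_EFin; first by near=> n.
    rewrite -[X in _ --> X]addr0; apply: cvgD; first exact: cvg_cst.
    by rewrite -[X in _ --> X](mulr0 c); apply: cvgM; [exact: cvg_cst|exact: cvg_harmonic].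
exact: (cvg_unique _ lim1 lim2).
Unshelve. all: by end_near. Qed.

End OptionalStopping.

(** * Stages of the game *)

Section Stage.
Context (R : realType) (d : measure_display) (Omega : measurableType d).
Variables (P : probability Omega R) (F : R -> set (set Omega)) (sigma : R).
Variable (W : R -> Omega -> R).
Hypotheses (hF : filtration F) (hsigma : 0 < sigma).
Hypothesis hW : brownian_motion P F sigma W.
Implicit Types (p q a b t : R) (w : Omega) (tauA tauB : Omega -> \bar R).

Definition stage_time p tauA tauB w : \bar R :=
  mine (mine (tauA w) (tauB w)) (end_time W p w).

(** The ways in which a stage stops, and the null event that it does not,
    with the stopping time and the outcome as indices for rewriting. *)
Variant outcome_spec (raise : R -> R) p tauA tauB w : \bar R -> R -> Prop :=
| OutcomeA t of 0 <= t & tauA w = t%:E & (tauA w <= tauB w)%E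
    & (t%:E <= end_time W p w)%E :
    outcome_spec raise p tauA tauB w t%:E (raise (p + W t w))
| OutcomeB t of 0 <= t & tauB w = t%:E & (tauB w < tauA w)%E
    & (t%:E <= end_time W p w)%E :
    outcome_spec raise p tauA tauB w t%:E (- raise (1 - (p + W t w)))
| OutcomeEnd1 t of 0 <= t & end_time W p w = t%:E & (t%:E < tauA w)%E
    & (t%:E < tauB w)%E & p + W t w = 1 :
    outcome_spec raise p tauA tauB w t%:E 1
| OutcomeEnd0 t of 0 <= t & end_time W p w = t%:E & (t%:E < tauA w)%E
    & (t%:E < tauB w)%E & p + W t w = 0 :
    outcome_spec raise p tauA tauB w t%:E (-1)
| OutcomeNever : outcome_spec raise p tauA tauB w +oo%E 0.

Lemma outcomeP raise p tauA tauB w : (0 <= tauA w)%E -> (0 <= tauB w)%E ->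
  outcome_spec raise p tauA tauB w (stage_time p tauA tauB w)
    (outcome W raise p tauA tauB w).
Proof.
move=> A0 B0; rewrite /outcome /stage_time.
have fin (s : \bar R) : (0 <= s)%E -> (s < +oo)%E -> exists2 t, s = t%:E & 0 <= t.
  by case: s => // t; rewrite lee_fin => t0 _; exists t.
have [AB|BA] := leP (tauA w) (tauB w); rewrite /=.
  have [AT|TA] := leP (tauA w) (end_time W p w); rewrite /=.
    have [Aoo|] := ltP (tauA w) +oo%E.
      have [t tE t0] := fin _ A0 Aoo.
      by rewrite tE /=; apply: OutcomeA => //; rewrite -tE.
    rewrite leye_eq => /eqP Aoo; move: AB AT; rewrite Aoo !leye_eq => /eqP -> /eqP ->.
    by rewrite ltxx andbF; exact: OutcomeNever.
  have TB := lt_le_trans TA AB; rewrite leNgt TB /=.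
  have Too : (end_time W p w < +oo)%E by exact: lt_le_trans TA (leey _).
  rewrite Too; have [[Te _]|[t [TE t0 X01 _]]] := end_timeP hW p w.
    by move: Too; rewrite Te ltxx.
  rewrite TE/= in TA TB *; case: X01 => XE; rewrite XE.
    by rewrite eq_sym oner_eq0; exact: OutcomeEnd0.
  by rewrite eqxx; exact: OutcomeEnd1.
have [BT|TB] := leP (tauB w) (end_time W p w); rewrite /=.
  have Boo : (tauB w < +oo)%E by exact: lt_le_trans BA (leey _).
  have [t tE t0] := fin _ B0 Boo.
  by rewrite Boo tE /=; apply: OutcomeB => //; rewrite -tE.
have Too : (end_time W p w < +oo)%E by exact: lt_le_trans TB (leey _).
have TA := lt_trans TB BA.
rewrite Too; have [[Te _]|[t [TE t0 X01 _]]] := end_timeP hW p w.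
  by move: Too; rewrite Te ltxx.
rewrite TE/= in TA TB *; case: X01 => XE; rewrite XE.
  by rewrite eq_sym oner_eq0; exact: OutcomeEnd0.
by rewrite eqxx; exact: OutcomeEnd1.
Qed.

Lemma stopping_time_stage p tauA tauB : stopping_time F tauA ->
  stopping_time F tauB -> stopping_time F (stage_time p tauA tauB).
Proof.
move=> sA sB; apply: (stopping_time_min hF); last exact: (stopping_time_end hF hW).
exact: (stopping_time_min hF).
Qed.

Lemma stage_time_le_end p tauA tauB w :
  (stage_time p tauA tauB w <= end_time W p w)%E.
Proof. by rewrite /stage_time ge_min lexx orbT. Qed.

Section Comparison.
Variables (raise : R -> R) (C p a b : R) (tauA tauB : Omega -> \bar R).
Hypotheses (p01 : 0 <= p <= 1).
Hypotheses (sA : stopping_time F tauA) (sB : stopping_time F tauB).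

Local Notation affine := (stopped_affine W p a b (stage_time p tauA tauB)).

Let A0 w : (0 <= tauA w)%E. Proof. by case: sA. Qed.
Let B0 w : (0 <= tauB w)%E. Proof. by case: sB. Qed.

Lemma stage_payoff_eq :
  (forall w, outcome W raise p tauA tauB w = affine w) ->
  stage_payoff P W raise p tauA tauB = a + b * p.
Proof.
move=> /funext E; rewrite /stage_payoff E (optional_stopping hF hsigma hW)//.
  exact: stopping_time_stage.
exact: stage_time_le_end.
Qed.

Hypothesis raiseC : forall q, 0 <= q <= 1 -> `|raise q| <= C.

Let bnd := 1 + C + `|a| + `|b|.

Let C0 : 0 <= C.
Proof. by apply: le_trans (normr_ge0 (raise 0)) _; apply: raiseC; rewrite lexx ler01. Qed.

Let outcome_bound w : `|outcome W raise p tauA tauB w| <= bnd.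
Proof.
have ab0 : 0 <= `|a| + `|b| by exact: addr_ge0.
have := C0; case: outcomeP => // [t t0 _ _ tT|t t0 _ _ tT|_ _ _ _ _ _|_ _ _ _ _ _|] C0';
  rewrite ?normrN ?normr1 ?normr0 /bnd; try lra.
- have := raiseC (state_in01 hW p01 t0 tT); lra.
- have X01 := state_in01 hW p01 t0 tT.
  have : 0 <= 1 - (p + W t w) <= 1 by move: X01; lra.
  by move/raiseC; lra.
Qed.

Let affine_bound w : `|affine w| <= bnd.
Proof.
rewrite /stopped_affine /bnd; case: ifPn => [Soo|_]; last first.
  by rewrite normr0; have := C0; have := normr_ge0 a; have := normr_ge0 b; lra.
have S0 : (0 <= stage_time p tauA tauB w)%E by case: (stopping_time_stage p sA sB).
have Sfin : stage_time p tauA tauB w \is a fin_num by rewrite ge0_fin_numE.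
have X01 : 0 <= p + W (fine (stage_time p tauA tauB w)) w <= 1.
  apply: (state_in01 hW p01); first exact: fine_ge0.
  by rewrite fineK//; exact: stage_time_le_end.
apply: le_trans (ler_normD _ _) _; rewrite normrM.
move: X01; set X := p + _ => /andP[X0 X1]; rewrite (ger0_norm X0).
have : `|b| * X <= `|b| by rewrite ler_piMr.
by have := C0; lra.
Qed.

Lemma stage_payoff_le :
  (forall w, outcome W raise p tauA tauB w <= affine w) ->
  stage_payoff P W raise p tauA tauB <= a + b * p.
Proof.
move=> le; rewrite -[leRHS]/(fine (a + b * p)%:E).
rewrite -(@optional_stopping _ _ _ _ _ _ _ hF hsigma hW p (stage_time p tauA tauB))//.
- exact: expectation_bounded_mono outcome_bound affine_bound le.
- exact: stopping_time_stage.
- exact: stage_time_le_end.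
Qed.

Lemma stage_payoff_ge :
  (forall w, affine w <= outcome W raise p tauA tauB w) ->
  a + b * p <= stage_payoff P W raise p tauA tauB.
Proof.
move=> le; rewrite -[leLHS]/(fine (a + b * p)%:E).
rewrite -(@optional_stopping _ _ _ _ _ _ _ hF hsigma hW p (stage_time p tauA tauB))//.
- exact: expectation_bounded_mono affine_bound outcome_bound le.
- exact: stopping_time_stage.
- exact: stage_time_le_end.
Qed.

End Comparison.

(** Without proposals the final payoff is twice the final state minus 1. *)
Lemma never_payoff raise p : 0 <= p <= 1 ->
  stage_payoff P W raise p never never = 2 * p - 1.
Proof.
move=> p01; rewrite [RHS]addrC; have sN := stopping_time_never hF.
apply: stage_payoff_eq => // w; rewrite /stopped_affine.
have [n0 _] := sN.
case: (outcomeP raise p (n0 w) (n0 w)) => //= [t _ _ _ _ ->|t _ _ _ _ ->]; rewrite ltry; ring.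
Qed.

(** By the intermediate value theorem the motion cannot jump over [e]. *)
Lemma before_hitting p e t w : 0 <= t -> (t%:E < raise_at W p e w)%E ->
  (p <= e -> p + W t w < e) /\ (e <= p -> e < p + W t w).
Proof.
move=> t0 tH.
have noc c : 0 <= c -> c <= t -> p + W c w <> e.
  move=> c0 ct Xc; move: tH; rewrite /raise_at.
  have [[_ /(_ c c0)]//|[s [-> s0 _ /(_ c c0 Xc) sc]]] := hitting_time_singletonP hW p e w.
  by rewrite lte_fin ltNge (le_trans sc ct).
split => pe; rewrite ltNge; apply/negP => h.
  have [|c [c0 ct]] := crossing hW (p := p) (v := e) (w := w) (lexx 0) t0.
    by rewrite (brownian0 hW) addr0; nra.
  exact: noc.
have [|c [c0 ct]] := crossing hW (p := p) (v := e) (w := w) (lexx 0) t0.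
  by rewrite (brownian0 hW) addr0; nra.
exact: noc.
Qed.

Lemma raise_at_state p e t w : raise_at W p e w = t%:E -> p + W t w = e.
Proof.
rewrite /raise_at; have [[-> //]|[s [-> _ Xs _]]] := hitting_time_singletonP hW p e w.
by case=> <-.
Qed.

End Stage.

(** * The thresholds *)

(** The recursion satisfied by the thresholds, started from the state in which
    the payoff [2 * p - 1] without doubling equals [x]. *)
Fixpoint threshold (R : realType) (x y : R) (k : nat) : R :=
  if k is k'.+1 then 1 - (y - x) / (y * (1 + x)) * threshold x y k'
  else (1 + x) / 2.

Section Threshold.
Context (R : realType) (x y : R).
Hypotheses (hx : 0 < x) (hxy : x < y) (hy : 1 < y).

Let y0 : 0 < y. Proof. exact: lt_trans hy. Qed.

Let xy1 : 0 < x * (y - 1).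
Proof. by rewrite mulr_gt0// subr_gt0. Qed.

Lemma thresholdE k : threshold x y k =
  y * (x + 1) / (2 * y + x * y - x) +
  x * (1 + x) * (y - 1) / (2 * (2 * y + x * y - x)) *
    (- ((y - x) / (y * (1 + x)))) ^+ k.
Proof.
have D0 : 2 * y + x * y - x != 0.
  by rewrite lt0r_neq0//; have := y0; have := xy1; lra.
have y1 : y != 0 by exact: lt0r_neq0.
have x1 : 1 + x != 0 by rewrite lt0r_neq0// addr_gt0.
elim: k => [|k /= ->].
  by rewrite expr0 /=; field.
by rewrite exprS; set e := _ ^+ k; field; rewrite x1 y1.
Qed.

Lemma thresholdS k :
  y * (1 + x) * (1 - threshold x y k.+1) = (y - x) * threshold x y k.
Proof.
rewrite /=; set D := threshold x y k; field.
by rewrite lt0r_neq0 ?addr_gt0// lt0r_neq0.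
Qed.

Lemma threshold1 : 2 * y * threshold x y 1 = x + y.
Proof. by rewrite /=; field; rewrite lt0r_neq0 ?addr_gt0// lt0r_neq0. Qed.

(** The recursion is an antitone contraction whose fixed point lies between
    the thresholds 1 and 0, so all later thresholds stay between these two. *)
Lemma threshold_bounds k :
  threshold x y 1 <= threshold x y k.+1 /\ threshold x y k.+1 < (1 + x) / 2.
Proof.
elim: k => [|k [IH1 IH2]].
  split; first exact: lexx.
  have y2 : 0 < 2 * y by rewrite mulr_gt0.
  by rewrite -(ltr_pM2l y2) threshold1; have := xy1; lra.
have e2 := thresholdS k.+1; have e1 := thresholdS 0; have e0 := threshold1.
move: IH1 IH2 e0 e1 e2; rewrite [threshold x y 0]/=.
set D1 := threshold x y 1; set D := threshold x y k.+1; set E := threshold x y k.+2.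
clearbody D1 D E => h1 h2 e0 e1 e2.
have y1x : 0 < y * (1 + x) by rewrite mulr_gt0// addr_gt0.
split.
  have : y * (1 + x) * (1 - E) <= y * (1 + x) * (1 - D1).
    by rewrite e1 e2 ler_wpM2l ?ltW// subr_gt0.
  by rewrite ler_pM2l//; lra.
rewrite -(ltr_pM2l (mulr_gt0 y0 y1x)).
have h3 : (y - x) * D1 <= (y - x) * D by rewrite ler_wpM2l// subr_ge0 ltW.
have h4 : y * (y * (1 + x) * (1 - E)) >= (y - x) * (y * D1).
  by rewrite e2 mulrCA ler_pM2l.
have h5 : y * D1 = (x + y) / 2 by lra.
have h6 : 0 < x ^+ 2 * (y ^+ 2 - 1).
  by rewrite mulr_gt0// ?exprn_gt0// subr_gt0 expr_gt1// ltW.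
rewrite h5 in h4; lra.
Qed.

Lemma threshold_gt_half k : 1 / 2 < threshold x y k.
Proof.
case: k => [|k]; first by have := hx; rewrite /=; lra.
have [+ _] := threshold_bounds k; have := threshold1.
set D1 := threshold x y 1; set D := threshold x y k.+1 => e1 DD1.
have : 0 < y * (2 * D1 - 1) by have := hx; lra.
by rewrite pmulr_rgt0//; lra.
Qed.

Lemma threshold_le0 k : threshold x y k <= (1 + x) / 2.
Proof. by case: k => [|k]; [exact: lexx|have [_ /ltW] := threshold_bounds k]. Qed.

Lemma thresholdS_lt1 k : threshold x y k.+1 < 1.
Proof.
have := thresholdS k; have := threshold_gt_half k.
set D := threshold x y k; set D' := threshold x y k.+1 => h e.
have y1x : 0 < y * (1 + x) by rewrite mulr_gt0// addr_gt0.
have : 0 < y * (1 + x) * (1 - D') by rewrite e mulr_gt0 ?subr_gt0//; move: h; lra.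
by rewrite pmulr_rgt0// subr_gt0.
Qed.

End Threshold.

(** * One step of the recursion *)

(** Above the threshold [D] the value is not determined: there it enters the
    analysis of the preceding stage only through these two bounds. *)
Definition chord_value (R : realType) (x D : R) (V : R -> R) : Prop :=
  forall p, 0 <= p <= 1 -> [/\ 2 * p - 1 <= V p, V p <= -1 + (1 + x) / D * p &
    p <= D -> V p = -1 + (1 + x) / D * p].

Section Raise.
Context (R : realType) (x y : R).
Hypotheses (hx : 0 < x) (hxy : x < y) (hy : 1 < y).
Variables (k : nat) (V : R -> R).
Local Notation D := (threshold x y k).
Local Notation D' := (threshold x y k.+1).
Hypothesis hV : chord_value x D V.
Local Notation raise := (proposal_payoff x y V).
Implicit Types q : R.

Let m := (1 + x) / D.
Let m' := (1 + x) / D'.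

Let y0 : 0 < y. Proof. exact: lt_trans hy. Qed.
Let D_gt : 1 / 2 < D. Proof. exact: threshold_gt_half. Qed.
Let D'_gt : 1 / 2 < D'. Proof. exact: threshold_gt_half. Qed.
Let D_le : D <= (1 + x) / 2. Proof. exact: threshold_le0. Qed.
Let D'_lt : D' < (1 + x) / 2. Proof. by have [] := threshold_bounds hx hxy hy k. Qed.
Let D'_lt1 : D' < 1. Proof. exact: thresholdS_lt1. Qed.
Let D0 : 0 < D. Proof. by move: D_gt; lra. Qed.
Let D'0 : 0 < D'. Proof. by move: D'_gt; lra. Qed.
Let mD : m * D = 1 + x. Proof. by rewrite /m divfK// lt0r_neq0. Qed.
Let m'D' : m' * D' = 1 + x. Proof. by rewrite /m' divfK// lt0r_neq0. Qed.

Let m_ge2 : 2 <= m. Proof. by rewrite /m ler_pdivlMr//; move: D_le; lra. Qed.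
Let m'_gt2 : 2 < m'. Proof. by rewrite /m' ltr_pdivlMr//; move: D'_lt; lra. Qed.

Let raiseE q : raise q = Num.min x (- (y * V (1 - q))).
Proof. by rewrite /proposal_payoff oppr_max opprK. Qed.

Lemma raise_le q : raise q <= x.
Proof. by rewrite raiseE ge_min lexx. Qed.

(** An opponent who accepts can at least decline to propose again. *)
Lemma raise_le_double q : 0 <= q <= 1 -> raise q <= y * (2 * q - 1).
Proof.
move=> q01; have [|h _ _] := hV (p := 1 - q); first by move: q01; lra.
rewrite raiseE ge_min; apply/orP; right.
by rewrite -mulrN ler_wpM2l ?(ltW y0)//; move: h; lra.
Qed.

(* The recursion for the thresholds: at [D'] the opponent is indifferent
   between paying [x] and continuing. *)
Let slope : y * m * (1 - D') = y - x.
Proof.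
rewrite /m [LHS](_ : _ = y * (1 + x) * (1 - D') / D); last by ring.
by rewrite thresholdS// mulfK// lt0r_neq0.
Qed.

Let compl_D'_le : 1 - D' <= D.
Proof.
have y1x : 0 < y * (1 + x) by rewrite mulr_gt0// addr_gt0.
rewrite -(ler_pM2l y1x) thresholdS//.
apply: ler_wpM2r; first exact: ltW.
by have := mulr_gt0 hx y0; have := hx; lra.
Qed.

Lemma raise_le_chord q : 0 <= q <= 1 -> 1 - q <= D ->
  raise q <= x - y * m * (D' - q).
Proof.
move=> q01 qD; have [|_ _ /(_ qD) h] := hV (p := 1 - q); first by move: q01; lra.
rewrite raiseE ge_min; apply/orP; right; rewrite h -/m.
by have := slope; lra.
Qed.

Lemma raise_at_threshold : raise D' = x.
Proof.
have [|_ _ /(_ compl_D'_le) h] := hV (p := 1 - D'); first by move: D'_gt D'_lt1; lra.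
rewrite raiseE h -/m (_ : - _ = x) ?minxx//.
by have := slope; lra.
Qed.

(** Both lines have value [x] at [D'], and the payoff after acceptance is the
    steeper one.  Where the opponent's state exceeds [D], the state [q] is below
    one half, and never proposing again gives the opponent enough. *)
Lemma raise_lt_line q : 0 <= q <= 1 -> q < D' -> raise q < -1 + m' * q.
Proof.
move=> q01 qD'; have [qD|qD] := leP (1 - q) D.
  apply: le_lt_trans (raise_le_chord q01 qD) _.
  have mm : m' < y * m.
    rewrite -(ltr_pM2r D'0) m'D'; have := slope.
    have : y * 2 <= y * m by rewrite ler_pM2l.
    by have := hy; lra.
  have : m' * (D' - q) < y * m * (D' - q) by rewrite ltr_pM2r// subr_gt0.
  by have := m'D'; lra.
apply: le_lt_trans (raise_le_double q01) _.
have q2 : 0 < 1 - 2 * q by move: qD D_gt; lra.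
have : 1 * (1 - 2 * q) < y * (1 - 2 * q) by rewrite ltr_pM2r.
have : 2 * q <= m' * q by rewrite ler_wpM2r ?(ltW m'_gt2)//; case/andP: q01.
lra.
Qed.

Lemma raise_le_line q : 0 <= q <= 1 -> raise q <= -1 + m' * q.
Proof.
move=> q01; have [D'q|/(raise_lt_line q01)/ltW//] := leP D' q.
apply: le_trans (raise_le q) _.
have : m' * D' <= m' * q by rewrite ler_wpM2l// (le_trans _ (ltW m'_gt2)).
by have := m'D'; lra.
Qed.

(** The affine function with values [x] at the threshold and [- x] at the
    symmetric state, where the opponent raises, also dominates. *)
Lemma raise_le_symmetric q : 0 <= q <= 1 ->
  raise q <= - (x / (2 * D' - 1)) + 2 * x / (2 * D' - 1) * q.
Proof.
move=> q01; have D2 : 0 < 2 * D' - 1 by move: D'_gt; lra.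
set b := 2 * x / (2 * D' - 1).
have -> : x / (2 * D' - 1) = b / 2 by rewrite /b; field; exact: lt0r_neq0.
have b0 : 0 < b by rewrite divr_gt0// mulr_gt0.
have bD : b * (2 * D' - 1) = 2 * x by rewrite /b divfK// lt0r_neq0.
have [D'q|qD'] := leP D' q.
  apply: le_trans (raise_le q) _.
  have : b * D' <= b * q by rewrite ler_pM2l.
  lra.
have [qD|qD] := leP (1 - q) D.
  apply: le_trans (raise_le_chord q01 qD) _.
  have bm : b <= y * m.
    rewrite -(ler_pM2r D2) bD; have := slope.
    have : y * 2 <= y * m by rewrite ler_pM2l.
    lra.
  have : b * (D' - q) <= y * m * (D' - q) by rewrite ler_wpM2r// subr_ge0 ltW.
  lra.
apply: le_trans (raise_le_double q01) _.
have q2 : 0 < 1 - 2 * q by move: qD D_gt; lra.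
have by2 : b / 2 <= y.
  rewrite -(ler_pM2r D2).
  have [D1 _] := threshold_bounds hx hxy hy k.
  have : y * threshold x y 1 <= y * D' by rewrite ler_pM2l.
  by have := threshold1 hx hy; lra.
have : b / 2 * (1 - 2 * q) <= y * (1 - 2 * q) by rewrite ler_pM2r.
lra.
Qed.

Lemma raise_bounded q : 0 <= q <= 1 -> `|raise q| <= x + y * m.
Proof.
move=> q01; have [|_ h _] := hV (p := 1 - q); first by move: q01; lra.
have ym : 0 <= y * m by rewrite mulr_ge0 ?(ltW y0)// (le_trans _ m_ge2).
rewrite ler_norml (le_trans (raise_le q)) ?lerDl// andbT raiseE le_min.
apply/andP; split; first by have := hx; lra.
have : y * V (1 - q) <= y * (-1 + m * (1 - q)) by rewrite ler_wpM2l// ltW.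
have : 0 <= y * m * q by rewrite mulr_ge0//; case/andP: q01.
have := y0; have := hx; lra.
Qed.

End Raise.

(** * The value of the game and the equilibrium *)

Section Game.
Context (R : realType) (d : measure_display) (Omega : measurableType d).
Variables (P : probability Omega R) (F : R -> set (set Omega)) (sigma : R).
Variable (W : R -> Omega -> R).
Hypotheses (hF : filtration F) (hsigma : 0 < sigma).
Hypothesis hW : brownian_motion P F sigma W.
Variables (x y : R).
Hypotheses (hx : 0 < x) (hxy : x < y) (hy : 1 < y).
Implicit Types (p q : R) (w : Omega) (tau : Omega -> \bar R).

Local Notation value := (value P F W x y).
Local Notation raise k := (proposal_payoff x y (value k)).

Let stop_never : stopping_time F never. Proof. exact: stopping_time_never hF. Qed.
Let never0 w : (0 <= never w :> \bar R)%E. Proof. by case: stop_never. Qed.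
Let stop_raise p e : stopping_time F (raise_at W p e).
Proof. exact: (stopping_time_raise_at hF hW). Qed.
Let raise_at0 p e w : (0 <= raise_at W p e w)%E.
Proof. by case: (stop_raise p e). Qed.

Section Step.
Variable k : nat.
Local Notation D := (threshold x y k).
Local Notation D' := (threshold x y k.+1).
Hypothesis hV : chord_value x D (value k).

Let D'_gt : 1 / 2 < D'. Proof. exact: threshold_gt_half. Qed.
Let D'_lt1 : D' < 1. Proof. exact: thresholdS_lt1. Qed.
Let D'0 : 0 < D'. Proof. by move: D'_gt; lra. Qed.
Let D'_lt : D' < (1 + x) / 2. Proof. by have [] := threshold_bounds hx hxy hy k. Qed.
Let m'D' : (1 + x) / D' * D' = 1 + x. Proof. by rewrite divfK// lt0r_neq0. Qed.

Lemma raise_at_payoff p : 0 <= p -> p <= D' ->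
  stage_payoff P W (raise k) p (raise_at W p D') never = -1 + (1 + x) / D' * p.
Proof.
move=> p0 pD; have p01 : 0 <= p <= 1 by move: D'_lt1; rewrite p0; lra.
apply: (stage_payoff_eq hF hsigma hW) => // w; rewrite /stopped_affine.
case: (outcomeP hW (raise k) p (raise_at0 p D' w) (never0 w)) => //=.
- move=> t t0 /(raise_at_state hW) -> _ _.
  by rewrite ltry (raise_at_threshold hx hxy hy hV) m'D'; ring.
- move=> t t0 _ tr _ X1; have [/(_ pD) + _] := before_hitting hW t0 tr.
  by rewrite X1 ltNge (ltW D'_lt1).
- by move=> t t0 _ tr _ ->; rewrite ltry; ring.
Qed.

(** At the end of the game the line has value [-1] after a loss, and at least
    [1] after a win because its slope is at least 2. *)
Lemma payoff_le_line p tau : 0 <= p <= 1 -> stopping_time F tau ->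
  stage_payoff P W (raise k) p tau never <= -1 + (1 + x) / D' * p.
Proof.
move=> p01 stau; have tau0 w : (0 <= tau w)%E by case: stau.
apply: (stage_payoff_le hF hsigma hW p01 stau stop_never (raise_bounded hx hxy hy hV)) => w.
rewrite /stopped_affine; case: (outcomeP hW (raise k) p (tau0 w) (never0 w)) => //=.
- move=> t t0 _ _ tT; rewrite ltry; apply: (raise_le_line hx hxy hy hV).
  exact: (state_in01 hW).
- move=> t t0 _ _ _ ->; rewrite ltry mulr1.
  have : 2 <= (1 + x) / D' by rewrite ler_pdivlMr//; move: D'_lt; lra.
  lra.
- by move=> t t0 _ _ _ ->; rewrite ltry mulr0 addr0.
Qed.

Lemma chord_valueS : chord_value x D' (value k.+1).
Proof.
move=> p p01; rewrite /=; set A := [set _ | _ in _].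
have ubA : ubound A (-1 + (1 + x) / D' * p).
  by move=> _ [tau stau <-]; exact: payoff_le_line.
have A_ne : A !=set0.
  by exists (stage_payoff P W (raise k) p never never); exists never.
have hA : has_sup A by split => //; exists (-1 + (1 + x) / D' * p).
split.
- rewrite -(never_payoff hF hsigma hW (raise k) p01); apply: ub_le_sup; first by case: hA.
  by exists never.
- exact: ge_sup.
- move=> pD; apply/eqP; rewrite eq_le ge_sup//=.
  rewrite -raise_at_payoff//; last by case/andP: p01.
  by apply: ub_le_sup; [case: hA|exists (raise_at W p D')].
Qed.

(** The affine function with values [x] at [D'] and [- x] at [1 - D'] is equal
    to the payoff of the two threshold strategies, dominates it for every
    strategy of A against the threshold of B, and is dominated by it for every
    strategy of B against the threshold of A. *)
Lemma symmetric_equilibrium p tau : 1 - D' <= p -> p <= D' ->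
  stopping_time F tau ->
  stage_payoff P W (raise k) p tau (raise_at W p (1 - D')) <=
    stage_payoff P W (raise k) p (raise_at W p D') (raise_at W p (1 - D')) /\
  stage_payoff P W (raise k) p (raise_at W p D') (raise_at W p (1 - D')) <=
    stage_payoff P W (raise k) p (raise_at W p D') tau.
Proof.
move=> pD1 pD stau; have tau0 w : (0 <= tau w)%E by case: stau.
have p01 : 0 <= p <= 1 by move: D'_lt1; lra.
have raiseD := raise_at_threshold hx hxy hy hV.
have raiseC := raise_bounded hx hxy hy hV.
have raiseM := raise_le_symmetric hx hxy hy hV.
set a := - (x / (2 * D' - 1)) in raiseM.
set b := 2 * x / (2 * D' - 1) in raiseM.
have D2 : 0 < 2 * D' - 1 by move: D'_gt; lra.
have aE : a = - (b / 2) by rewrite /a /b; field; exact: lt0r_neq0.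
have bD : b * (2 * D' - 1) = 2 * x by rewrite /b divfK// lt0r_neq0.
have b2 : 2 < b by rewrite /b ltr_pdivlMr//; move: D'_lt; lra.
have aD : a + b * D' = x by rewrite aE; lra.
have aD1 : a + b * (1 - D') = - x by rewrite aE; lra.
have eqD : stage_payoff P W (raise k) p (raise_at W p D') (raise_at W p (1 - D')) = a + b * p.
  apply: (stage_payoff_eq hF hsigma hW) => // w; rewrite /stopped_affine.
  case: (outcomeP hW (raise k) p (raise_at0 p D' w) (raise_at0 p (1 - D') w)) => //=.
  - by move=> t t0 /(raise_at_state hW) -> _ _; rewrite ltry raiseD aD.
  - by move=> t t0 /(raise_at_state hW) -> _ _; rewrite ltry subKr raiseD aD1.
  - move=> t t0 _ tr _ X1; have [/(_ pD) + _] := before_hitting hW t0 tr.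
    by rewrite X1 ltNge (ltW D'_lt1).
  - move=> t t0 _ _ tr X0; have [_ /(_ pD1)] := before_hitting hW t0 tr.
    by rewrite X0 subr_lt0 ltNge (ltW D'_lt1).
rewrite eqD; split.
  apply: (stage_payoff_le hF hsigma hW p01 stau (stop_raise _ _) raiseC) => w.
  rewrite /stopped_affine.
  case: (outcomeP hW (raise k) p (tau0 w) (raise_at0 p (1 - D') w)) => //=.
  - by move=> t t0 _ _ tT; rewrite ltry; apply: raiseM; exact: (state_in01 hW).
  - by move=> t t0 /(raise_at_state hW) -> _ _; rewrite ltry subKr raiseD aD1.
  - by move=> t t0 _ _ _ ->; rewrite ltry aE; move: b2; lra.
  - move=> t t0 _ _ tr X0; have [_ /(_ pD1)] := before_hitting hW t0 tr.
    by rewrite X0 subr_lt0 ltNge (ltW D'_lt1).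
apply: (stage_payoff_ge hF hsigma hW p01 (stop_raise _ _) stau raiseC) => w.
rewrite /stopped_affine.
case: (outcomeP hW (raise k) p (raise_at0 p D' w) (tau0 w)) => //=.
- by move=> t t0 /(raise_at_state hW) -> _ _; rewrite ltry raiseD aD.
- move=> t t0 _ _ tT; rewrite ltry; have X01 := state_in01 hW p01 t0 tT.
  have /raiseM : 0 <= 1 - (p + W t w) <= 1 by move: X01; lra.
  by rewrite aE; lra.
- move=> t t0 _ tr _ X1; have [/(_ pD) + _] := before_hitting hW t0 tr.
  by rewrite X1 ltNge (ltW D'_lt1).
- by move=> t t0 _ _ _ ->; rewrite ltry aE; move: b2; lra.
Qed.

End Step.

Lemma value_chord k : chord_value x (threshold x y k) (value k).
Proof.
elim: k => [|k]; last exact: chord_valueS.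
move=> p p01; rewrite /= (never_payoff hF hsigma hW)//.
have -> : (1 + x) / ((1 + x) / 2) = 2.
  by field; rewrite lt0r_neq0// addr_gt0.
by split => [||_]; lra.
Qed.

End Game.

Theorem theorem1p4 (R : realType) (disp : measure_display)
    (Omega : measurableType disp) (P : probability Omega R)
    (F : R -> set (set Omega)) (sigma : R) (W : R -> Omega -> R)
    (hF : filtration F) (hsigma : 0 < sigma)
    (hW : brownian_motion P F sigma W)
    (x y : R) (hx : 0 < x) (hxy : x < y) (hy : 1 < y)
    (k : nat) (hk : (1 <= k)%N) :
  let d_k := y * (x + 1) / (2 * y + x * y - x)
             + x * (1 + x) * (y - 1) / (2 * (2 * y + x * y - x))
               * (- ((y - x) / (y * (1 + x)))) ^+ k in
  (forall d : R, optimal_raising_state P F W x y k d <-> d = d_k) /\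
  [/\ raise_payoff P F W x y k d_k = x,
      payoff P F W x y k d_k never never = 2 * d_k - 1
    & 2 * d_k - 1 < x].
Proof.
rewrite /= -thresholdE//; case: k hk => // k _.
have hV := value_chord hF hsigma hW hx hxy hy k.
have hV' := chord_valueS hF hsigma hW hx hxy hy hV.
have D_gt := threshold_gt_half hx hxy hy k.+1.
have D_lt1 := thresholdS_lt1 hx hxy hy k.
have [_ D_lt] := threshold_bounds hx hxy hy k.
set D := threshold x y k.+1 in hV' D_gt D_lt1 D_lt *.
have raiseD : raise_payoff P F W x y k.+1 D = x := raise_at_threshold hx hxy hy hV.
have D0 : 0 < D by move: D_gt; lra.
have D01 : 0 <= D <= 1 by move: D0 D_lt1; lra.
have valueE p : 0 <= p -> p <= D -> value P F W x y k.+1 p = -1 + (1 + x) / D * p.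
  by move=> p0 pD; have [|_ _ ->//] := hV' p; move: D_lt1; lra.
have valueD : value P F W x y k.+1 D = x.
  by rewrite valueE ?(ltW D0)// divfK ?lt0r_neq0//; ring.
split; last split => //; first last.
- by move: D_lt; lra.
- exact: never_payoff hF hsigma hW _ _ D01.
move=> d; split => [[d01 below upto _]|->]; last first.
  split => //.
  - move=> q q0 qD; rewrite valueE ?(ltW qD)//.
    by apply: (raise_lt_line hx hxy hy hV) => //; move: qD D_lt1; lra.
  - move=> p p0 pD; split; first exact: (stopping_time_raise_at hF hW).
    by rewrite valueE//; exact: (raise_at_payoff hF hsigma hW hx hxy hy hV).
  - move=> p pD1 pD tau stau.
    exact: (symmetric_equilibrium hF hsigma hW hx hxy hy hV).
case/andP: d01 => d0 d1; have [dD|Dd|//] := ltgtP d D; last first.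
  by have := below D (ltW D0) Dd; rewrite raiseD valueD ltxx.
have [_ ] := upto d d0 (lexx d).
(* From the state [d] the strategy of raising at [d] raises at once. *)
have raise_now : payoff P F W x y k.+1 d (raise_at W d d) never =
    raise_payoff P F W x y k.+1 d + 0 * d.
  have sN := stopping_time_never hF; have sd := stopping_time_raise_at hF hW d d.
  have [N0 _] := sN; have [R0 _] := sd.
  apply: (stage_payoff_eq hF hsigma hW) => //; first by rewrite d0 ltW// (lt_trans dD).
  move=> w; rewrite /stopped_affine mul0r addr0.
  case: (outcomeP hW (raise_payoff P F W x y k.+1) d (R0 w) (N0 w)) => //=.
  - by move=> t t0 /(raise_at_state hW) -> _ _; rewrite ltry.
  - move=> t t0 _ tr _ _; have [/(_ (lexx d)) h1 /(_ (lexx d)) h2] := before_hitting hW t0 tr.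
    by have := lt_trans h1 h2; rewrite ltxx.
  - move=> t t0 _ tr _ _; have [/(_ (lexx d)) h1 /(_ (lexx d)) h2] := before_hitting hW t0 tr.
    by have := lt_trans h1 h2; rewrite ltxx.
rewrite raise_now mul0r addr0 valueE ?(ltW dD)// => e.
have := raise_lt_line hx hxy hy hV (q := d); rewrite d0 d1 => /(_ isT dD).
by rewrite -[proposal_payoff _ _ _ _]/(raise_payoff P F W x y k.+1 d) e ltxx.
Qed.
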